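(* Let $(Z_n)_{n\ge 0}$ be a supercritical branching process with immigration in an i.i.d. random environment (as described in the context), with $0<m_1<\infty$ a.s., $\mathbb{E}\log m_1\in(0,\infty)$ and $\mathbb{P}(h(\{0\})<1)>0$. Assume that (A) $\mathbb{P}\big(h(\{0\})>0,\ f(\{0\})>0,\ f(\{1\})>0\big)>0$, and (B) there exists $\delta\in(0,1)$ such that $f(\{0\})<\delta$ a.s. Then there are $\theta\in(0,\mathbb{E}\log m_1)$, $\beta>0$ and $C>0$ such that for all integers $k\ge1$ and $n\ge1$, $$\mathbb{P}_k(1\le Z_n\le e^{\theta n})\le C e^{-\beta n}.$$
   Context: $\mathbb{N}=\{0,1,2,\dots\}$. Let $\Delta$ be the space of pairs of probability measures on $\mathbb{N}$, with the component-wise total variation metric. Let $\mathbf Q=(f,h)$ be a random element of $\Delta$ and let $\mathbf Q_n=(f_n,h_n)$, $n\ge1$, be independent copies of $\mathbf Q$ (independence of $f_n$ and $h_n$ for fixed $n$ is not assumed). The sequence $\xi=(\mathbf Q_1,\mathbf Q_2,\dots)$ is the random environment. The branching process with immigration in the random environment $\xi$ is the $\mathbb{N}$-valued process $(Z_n)$ with $Z_0=k\in\mathbb{N}\setminus\{0\}$ which, given $\xi$, is a Markov chain satisfying $Z_n=\sum_{i=1}^{Z_{n-1}}N_{n,i}+Y_n$ for $n\ge1$, where given $\xi$ all the variables $N_{n,i},Y_n$ are independent (and independent of the past), the $N_{n,i}$, $i\ge1$, have law $f_n$ (offspring) and $Y_n$ has law $h_n$ (immigrants). $\mathbb{P}$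 is the annealed probability (averaged over $\xi$), $\mathbb{E}$ its expectation; $\mathbb{P}_k(\cdot)=\mathbb{P}(\cdot\mid Z_0=k)$. $m_n=\sum_{j\ge0} j f_n(\{j\})$ is the mean of $f_n$. *)

(* Defs.v *)
From mathcomp Require Export all_boot all_order all_algebra finmap.
From mathcomp Require Export all_classical all_reals all_analysis.
From mathcomp Require Export measurable_realfun.

Set Implicit Arguments.
Unset Strict Implicit.
Unset Printing Implicit Defensive.

Import Order.TTheory GRing.Theory Num.Theory.
Import numFieldNormedType.Exports.

Local Open Scope classical_set_scope.
Local Open Scope ring_scope.
Local Open Scope ereal_scope.

Definition tv_dist (R : realType) (p q : probability nat R) : R :=
  sup [set `|fine (p A) - fine (q A)|%R | A in [set A : set nat | measurable A]].

Definition delta_dist (R : realType)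
    (q q' : probability nat R * probability nat R) : R :=
  Num.max (tv_dist q.1 q'.1) (tv_dist q.2 q'.2).

Definition delta_open (R : realType) :
    set (set (probability nat R * probability nat R)) :=
  [set U | forall q, U q ->
     exists2 e : R, (0 < e)%R & forall q', (delta_dist q q' < e)%R -> U q'].

(* The space of pairs (offspring law, immigration law), with the Borel
   sigma-algebra of the component-wise total variation metric. *)
Definition Delta (R : realType) : measurableType _ :=
  g_sigma_algebraType (@delta_open R).

Definition offspring (R : realType) (q : Delta R) : probability nat R := q.1.
Definition immigration (R : realType) (q : Delta R) : probability nat R := q.2.

Definition mean (R : realType) (p : probability nat R) : \bar R :=
  \sum_(0 <= j <oo) j%:R%:E * p [set j].

Section Independence.
Context d (T : measurableType d) (R : realType) (P : probability T R).

(* The family (X i), i in D, is mutually independent. *)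
Definition independent_family d' (T' : measurableType d') (I : choiceType)
    (D : set I) (X : I -> {RV P >-> T'}) : Prop :=
  forall (J : {fset I}) (B : I -> set T'),
    [set` J] `<=` D -> (forall i, measurable (B i)) ->
    P (\bigcap_(i in [set` J]) (X i @^-1` B i)) =
    \prod_(i <- J) P (X i @^-1` B i).

(* g is a version of the conditional probability of E given the sigma-algebra
   generated by G. *)
Definition cond_prob_version (G : set (set T)) (E : set T) (g : T -> \bar R) :
    Prop :=
  measurable_fun setT (g : g_sigma_algebraType G -> \bar R) /\
  forall A, <<s G >> A -> \int[P]_(w in A) g w = P (A `&` E).

(* Given the sigma-algebra generated by G, the X i, i in D, are independent and
   X i has the random law L i. *)
Definition cond_independent_with_laws (G : set (set T)) d'
    (T' : measurableType d') (I : choiceType) (D : set I)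
    (X : I -> {RV P >-> T'}) (L : I -> T -> probability T' R) : Prop :=
  forall (J : {fset I}) (B : I -> set T'),
    [set` J] `<=` D -> (forall i, measurable (B i)) ->
    cond_prob_version G (\bigcap_(i in [set` J]) (X i @^-1` B i))
      (fun w => \prod_(i <- J) L i w (B i)).

End Independence.

Section BranchingProcess.
Context d (T : measurableType d) (R : realType) (P : probability T R).

(* Only the environments xi n with n >= 1 are used. *)
Definition iid_copies (Q : {RV P >-> Delta R}) (xi : nat -> {RV P >-> Delta R})
    : Prop :=
  (forall n B, (1 <= n)%N -> measurable B ->
     P (xi n @^-1` B) = P (Q @^-1` B)) /\
  independent_family [set n | (1 <= n)%N] xi.

(* Its generated sigma-algebra is the one of the whole environment. *)
Definition env_events (xi : nat -> {RV P >-> Delta R}) : set (set T) :=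
  \bigcup_(n in [set n | (1 <= n)%N]) preimage_set_system setT (xi n) measurable.

(* The variables N_{n,i} are indexed by inl (n, i), the Y_n by inr n. *)
Definition reproduction_index : choiceType := ((nat * nat) + nat)%type.

Definition reproduction_dom : set reproduction_index :=
  [set a | match a with
           | inl (n, i) => (1 <= n)%N /\ (1 <= i)%N
           | inr n => (1 <= n)%N
           end].

Definition reproduction_var (N : nat -> nat -> {RV P >-> nat})
    (Y : nat -> {RV P >-> nat}) (a : reproduction_index) : {RV P >-> nat} :=
  match a with inl (n, i) => N n i | inr n => Y n end.

Definition reproduction_law (xi : nat -> {RV P >-> Delta R})
    (a : reproduction_index) (w : T) : probability nat R :=
  match a with
  | inl (n, _) => offspring (xi n w)
  | inr n => immigration (xi n w)
  end.

Definition reproduction_given_env (xi : nat -> {RV P >-> Delta R})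
    (N : nat -> nat -> {RV P >-> nat}) (Y : nat -> {RV P >-> nat}) : Prop :=
  cond_independent_with_laws (env_events xi) reproduction_dom
    (reproduction_var N Y) (reproduction_law xi).

(* The process Z started from Z_0 = k. *)
Fixpoint bpire (N : nat -> nat -> {RV P >-> nat}) (Y : nat -> {RV P >-> nat})
    (k n : nat) (w : T) : nat :=
  if n is n'.+1 then
    (\sum_(1 <= i < (bpire N Y k n' w).+1) N n i w + Y n w)%N
  else k.

End BranchingProcess.

(* Main.v *)
Require Import Defs.
From mathcomp Require Import all_boot all_order all_algebra finmap.
From mathcomp Require Import all_classical all_reals all_analysis.
From mathcomp Require Import measurable_realfun.
From mathcomp Require Import ring lra zify.
Import Order.TTheory GRing.Theory Num.Theory.
Import numFieldNormedType.Exports.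
Local Open Scope classical_set_scope.
Local Open Scope ring_scope.
Local Open Scope ereal_scope.

(** Averaged over the environment, (Z_n) is a time-homogeneous Markov chain on
    the naturals: Z_(n+1) is obtained from Z_n = y by the variable
    next_size (n+1) y, whose law does not depend on n and which is independent
    of the past.  The bound follows from a Lyapunov function V, with values in
    [0, 1], that decreases at most polynomially and satisfies
    E V(next_size n y) <= rho V(y) for every y, with rho < 1.  Iterating gives
    E V(Z_n) <= rho^n uniformly in the starting point; on the event
    Z_n <= exp(theta n) one has V(Z_n) >= c exp(-theta n), and the inequality
    of Markov concludes when theta is small (lyapunov_tail).

    V is the minimum of two functions.  For large z it is
    z |-> ((1+K)/(1+z))^s.  Indeed, given the environment and for large y,
    next_size n y is at least of order y m_n, so that its contribution to the
    drift is close to E m^(-s), which is less than 1 for small s because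
    E log m > 0 (next_size_power_drift).  To make this quantitative, and
    uniform in the environment, offspring numbers are truncated at a level M:
    sums of bounded variables obey an exponential Chernoff bound
    (trunc_power_bound), and M is chosen by dominated convergence so that a
    lower bound mean_floor of the truncated mean still has positive expected
    logarithm (exists_log_mean_floor_pos).  The uniform bound on f({0}) is what
    keeps the truncated mean away from 0, hence the negative moment finite.

    Below the threshold there are finitely many states, and from each of them
    the chain moves strictly up with probability at least some eps > 0: from 0
    by immigration, from y >= 1 because all y individuals can have two
    children at once, as P(f(2, 3, ...) > 0) > 0 in the supercritical case
    (next_size_up).  There V is 1 minus a function growing geometrically fast
    with ratio 2/eps, which makes the reward of one step up outweigh the loss
    of falling anywhere else.

    The passage from the conditional description of the model to the Markov
    property is bpire_next_size_indep, a pi-lambda argument from the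
    independence of cylinder events of different generations
    (past_env_indep). *)

Set Implicit Arguments.
Unset Strict Implicit.
Unset Printing Implicit Defensive.

(** * Measurability and integration preliminaries *)

Section Generic.
Context d (T : measurableType d) (R : realType).

(** A countable index splits the preimage into countably many measurable pieces;
    this is what lets the number of summands in the recursion be random. *)
Lemma measurable_fun_natdep (D : set T) (F : T -> nat) (G : nat -> T -> nat) :
  measurable_fun D F -> (forall y, measurable_fun D (G y)) ->
  measurable_fun D (fun w => G (F w) w).
Proof.
move=> mF mG mD B mB.
have -> : D `&` (fun w => G (F w) w) @^-1` B =
    \bigcup_y ((D `&` F @^-1` [set y]) `&` (D `&` G y @^-1` B)).
  apply/seteqP; split => [w [Dw BGw]|w [y _ [[Dw <-] [_ BGw]]]//].
  by exists (F w).
apply: bigcupT_measurable => y; apply: measurableI.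
- exact: mF.
- exact: mG.
Qed.

Lemma measurable_fun_natD (D : set T) (F G : T -> nat) :
  measurable_fun D F -> measurable_fun D G ->
  measurable_fun D (fun w => (F w + G w)%N).
Proof.
move=> mF mG; apply: (@measurable_fun_natdep D F (fun y w => (y + G w)%N)) => //.
by move=> y; apply: (measurableT_comp _ mG).
Qed.

Lemma measurable_fun_natsum (D : set T) (I : eqType) (s : seq I)
    (F : I -> T -> nat) : (forall i, i \in s -> measurable_fun D (F i)) ->
  measurable_fun D (fun w => (\sum_(i <- s) F i w)%N).
Proof.
elim: s => [|i s IH] mF.
  by under eq_fun do rewrite big_nil; exact: measurable_cst.
under eq_fun do rewrite big_cons.
apply: measurable_fun_natD; first by apply: mF; rewrite mem_head.
by apply: IH => j js; apply: mF; rewrite inE js orbT.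
Qed.

End Generic.

Lemma integral_prob_cst d (T : measurableType d) (R : realType)
    (P : probability T R) (k : R) : \int[P]_w k%:E = k%:E.
Proof.
transitivity (k%:E * P setT); first exact: integral_cst.
by rewrite probability_setT mule1.
Qed.

Import HBNNSimple.

(** Upgrades a factorization over events of the form X in B to a factorization
    of expectations: both sides are linear and monotone in g, so the case of
    indicators gives simple functions and then all nonnegative g. *)
Lemma ge0_integral_weighted d d' (T : measurableType d) (S : measurableType d')
    (R : realType) (P : {measure set T -> \bar R}) (X : T -> S)
    (Phi : T -> \bar R) (c : R) (g : S -> \bar R) :
  measurable_fun setT X -> measurable_fun setT Phi -> (forall w, 0 <= Phi w) ->
  (forall w, Phi w \is a fin_num) ->
  (forall B, measurable B -> \int[P]_(w in X @^-1` B) Phi w =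
     c%:E * P (X @^-1` B)) ->
  measurable_fun setT g -> (forall x, 0 <= g x) ->
  \int[P]_w (Phi w * g (X w)) = c%:E * \int[P]_w g (X w).
Proof.
move=> mX mPhi Phi0 Phifin PhiX mg g0.
pose f_ := nnsfun_approx measurableT mg.
have mfX n : measurable_fun setT (fun w => (f_ n (X w))%:E).
  by apply/measurable_EFinP; exact: measurableT_comp.
have cvf w : (f_ n (X w))%:E @[n --> \oo] --> g (X w).
  by apply: cvg_nnsfun_approx => // *; exact: g0.
have ndf w : nondecreasing_seq (fun n => (f_ n (X w))%:E).
  by move=> m n mn; rewrite lee_fin; exact/lefP/nd_nnsfun_approx.
have simple n : \int[P]_w (Phi w * (f_ n (X w))%:E) =
    c%:E * \int[P]_w (f_ n (X w))%:E.
  have mpre r : measurable (X @^-1` (f_ n @^-1` [set r])).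
    by rewrite -(setTI (_ @^-1` _)); exact: mX.
  have indE r w : \1_(f_ n @^-1` [set r]) (X w) =
      \1_(X @^-1` (f_ n @^-1` [set r])) w :> R by [].
  have mind r : measurable_fun setT (fun w => \1_(f_ n @^-1` [set r]) (X w) : R).
    exact: (@measurable_indic _ T R setT _ (mpre r)).
  have level r : \int[P]_w (Phi w * (r * \1_(f_ n @^-1` [set r]) (X w))%:E) =
      c%:E * (r%:E * P (X @^-1` (f_ n @^-1` [set r]))).
    have [r0|r0] := ltP r 0%R.
      rewrite preimage_nnfun0// preimage_set0 measure0 !mule0.
      by apply: integral0_eq => w _; rewrite indic0 mulr0 mule0.
    under eq_integral do rewrite indE EFinM muleCA.
    rewrite ge0_integralZl//; last 2 first.
    - apply: emeasurable_funM => //; apply/measurable_EFinP.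
      exact: measurable_indic.
    - by move=> w _; rewrite mule_ge0// lee_fin.
    rewrite muleCA -PhiX//; congr (_ * _).
    rewrite [RHS]integral_mkcond; apply: eq_integral => w _.
    by rewrite epatch_indic.
  have decomp w : Phi w * (f_ n (X w))%:E = \sum_(r \in range (f_ n))
      (Phi w * (r * \1_(f_ n @^-1` [set r]) (X w))%:E).
    rewrite fimfunE -fsumEFin// ge0_mule_fsumr// => r.
    by rewrite nnfun_muleindic_ge0.
  under eq_integral do rewrite decomp.
  rewrite ge0_integral_fsum//; last 2 first.
  - move=> r; apply: emeasurable_funM => //; apply/measurable_EFinP.
    by apply: measurable_funM.
  - by move=> r w _; rewrite mule_ge0// EFinM nnfun_muleindic_ge0.
  under eq_fsbigr do rewrite level.
  rewrite -ge0_mule_fsumr; last first.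
    move=> r; have [r0|r0] := ltP r 0%R; last by rewrite mule_ge0// lee_fin.
    by rewrite preimage_nnfun0// preimage_set0 measure0 mule0.
  congr (_ * _); under [RHS]eq_integral do rewrite fimfunE -fsumEFin//.
  rewrite ge0_integral_fsum//; last 2 first.
  - move=> r; apply/measurable_EFinP.
    by apply: measurable_funM.
  - by move=> r w _; rewrite EFinM nnfun_muleindic_ge0.
  apply: eq_fsbigr => r _.
  rewrite (integralZl_indic _ (fun r => X @^-1` (f_ n @^-1` [set r])))//.
    by rewrite integral_indic// setIT.
  by move=> r0; rewrite preimage_nnfun0// preimage_set0.
transitivity (\int[P]_w limn (fun n => Phi w * (f_ n (X w))%:E)).
  apply: eq_integral => w _; apply/esym/cvg_lim => //.
  exact: cvgeZl.
rewrite monotone_convergence//; last 3 first.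
- by move=> n; exact: emeasurable_funM.
- by move=> n w _; rewrite mule_ge0// lee_fin.
- by move=> w _ m n mn; rewrite lee_wpmul2l//; exact: ndf.
under eq_fun do rewrite simple.
apply/cvg_lim => //; apply: cvgeZl => //.
have -> : \int[P]_w g (X w) = \int[P]_w limn (fun n => (f_ n (X w))%:E).
  by apply: eq_integral => w _; apply/esym/cvg_lim.
apply: cvg_monotone_convergence => // n w _.
by rewrite lee_fin.
Qed.

(** The class of events independent of a given one is a lambda-system, so that
    independence of two pi-systems passes to the sigma-algebras they generate,
    one side at a time. *)
Lemma pi_lambda_indep d (T : measurableType d) (R : realType)
    (P : probability T R) (C D : set (set T)) :
  setI_closed C -> setI_closed D -> C `<=` measurable -> D `<=` measurable ->
  (forall A B, C A -> D B -> P (A `&` B) = P A * P B) ->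
  forall A B, <<s C >> A -> <<s D >> B -> P (A `&` B) = P A * P B.
Proof.
have key (G : set (set T)) (B : set T) : setI_closed G -> G `<=` measurable ->
    measurable B -> (forall A, G A -> P (A `&` B) = P A * P B) ->
    forall A, <<s G >> A -> P (A `&` B) = P A * P B.
  move=> IG mG mB PG.
  pose H := [set A | measurable A /\ P (A `&` B) = P A * P B].
  suff HH : <<s G >> `<=` H by move=> A /HH[].
  apply: lambda_system_subset => //; last by move=> A GA; split; [exact: mG|exact: PG].
  apply/dynkin_lambda_system; split.
  - by split => //; rewrite setTI probability_setT mul1e.
  - move=> A [mA PA]; split; first exact: measurableC.
    rewrite setIC -setDE measureD ?(le_lt_trans (probability_le1 P mB)) ?ltry//.
    rewrite probability_setC// setIC.
    rewrite muleBl ?mul1e ?PA//.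
    - by congr (_ - _); exact: PA.
    - by rewrite fin_num_measure.
  - move=> F tF HF; split; first by apply: bigcup_measurable => n _; have [] := HF n.
    have mF n : measurable (F n) by have [] := HF n.
    rewrite setI_bigcupl measure_bigcup; last 2 first.
    + by move=> n _; exact: measurableI.
    + exact: trivIset_setIr.
    rewrite measure_bigcup// muleC -(fineK (fin_num_measure P B mB)).
    rewrite -nneseriesZl//; apply: eq_eseriesr => n _.
    by rewrite fineK ?fin_num_measure// muleC; have [] := HF n.
move=> IC ID mC mD PCD A B sA sB.
have sm (G : set (set T)) : G `<=` measurable -> <<s G >> `<=` measurable.
  move=> mG; apply: smallest_sub => //; exact: sigma_algebra_measurable.
rewrite setIC muleC; apply: (key D) => //; first exact: sm sA.
move=> B' DB'; rewrite setIC muleC; apply: (key C) => //; first exact: mD.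
by move=> A' CA'; exact: PCD.
Qed.

(** * Independence of the generations *)

Section DeltaMeasurability.
Context (R : realType).
Implicit Types q : Delta R.

Lemma le_tv_dist (p p' : probability nat R) (A : set nat) :
  (`|fine (p A) - fine (p' A)| <= tv_dist p p')%R.
Proof.
apply: ub_le_sup; last by exists A.
exists 1%R => _ [B _ <-].
have pB (r : probability nat R) : (0 <= fine (r B) <= 1)%R.
  by rewrite fine_ge0//= -lee_fin fineK ?fin_num_measure// probability_le1.
have := pB p; have := pB p'; rewrite ler_norml; lra.
Qed.

(** The mass of a fixed set is a 1-Lipschitz function of the law in total
    variation, so its strict upper level sets are open. *)
Lemma measurable_probability_of_set (law : Delta R -> probability nat R)
    (A : set nat) :
  (forall q q', (tv_dist (law q) (law q') <= delta_dist q q')%R) ->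
  measurable_fun setT (fun q => law q A).
Proof.
move=> lawtv; apply: (measurability _ (ErealGenOInfty.measurableE R)).
move=> _ [_ [x ->] <-]; rewrite setTI; apply: sub_sigma_algebra => q /=.
rewrite in_itv/= andbT -(fineK (fin_num_measure (law q) A _))// lte_fin => xq.
exists (fine (law q A) - x)%R; first by rewrite subr_gt0.
move=> q' qq'; rewrite in_itv/= andbT.
rewrite -(fineK (fin_num_measure (law q') A _))// lte_fin.
have := le_lt_trans (le_trans (le_tv_dist (law q) (law q') A) (lawtv q q')) qq'.
by rewrite ltr_norml; lra.
Qed.

Lemma measurable_offspring (A : set nat) :
  measurable_fun setT (fun q => offspring q A).
Proof.
by apply: measurable_probability_of_set => q q'; rewrite /delta_dist le_max lexx.
Qed.

Lemma measurable_immigration (A : set nat) :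
  measurable_fun setT (fun q => immigration q A).
Proof.
by apply: measurable_probability_of_set => q q'; rewrite /delta_dist le_max lexx orbT.
Qed.

End DeltaMeasurability.

Lemma prode_fsetU (R : realType) (I : choiceType) (J1 J2 : {fset I})
    (F : I -> \bar R) : (forall a, a \in J1 -> a \notin J2) ->
  \prod_(a <- (J1 `|` J2)%fset) F a = \prod_(a <- J1) F a * \prod_(a <- J2) F a.
Proof.
move=> J12; rewrite (big_fsetID _ (mem J1)) /=; congr (_ * _).
  by apply: eq_fbigl => a; rewrite !inE/=; case: (a \in J1); rewrite /= ?andbF.
apply: eq_fbigl => a; rewrite !inE/=.
by have := J12 a; case: (a \in J1) => /=; rewrite ?andbT ?andbF// => /(_ isT)/negbTE.
Qed.

Lemma fsetU_filter (I : choiceType) (J : {fset I}) (p : pred I) :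
  J = ([fset a in J | p a] `|` [fset a in J | ~~ p a])%fset.
Proof.
by apply/fsetP => a; rewrite !inE/=; case: (a \in J) => //=; case: (p a).
Qed.

Section Cylinders.
Context d (T : measurableType d) (R : realType) (P : probability T R).
Context (Q : {RV P >-> Delta R}) (xi : nat -> {RV P >-> Delta R}).
Context (N : nat -> nat -> {RV P >-> nat}) (Y : nat -> {RV P >-> nat}).
Context (xi_iid : iid_copies Q xi).
Context (NY_given_xi : reproduction_given_env xi N Y).

Implicit Types (J : {fset reproduction_index}) (K : {fset nat}).

Definition generation (a : reproduction_index) : nat :=
  match a with inl (n, _) => n | inr n => n end.

(** The law of a reproduction variable as a function of the environment of its
    own generation only. *)
Definition law_at (a : reproduction_index) (q : Delta R) : probability nat R :=
  match a with inl _ => offspring q | inr _ => immigration q end.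

Lemma reproduction_lawE a w :
  reproduction_law xi a w = law_at a (xi (generation a) w).
Proof. by case: a => [[n i]|n]. Qed.

Lemma measurable_law_at a A : measurable_fun setT (fun q => law_at a q A).
Proof.
by case: a => [_|_] /=; [exact: measurable_offspring|exact: measurable_immigration].
Qed.

Lemma measurable_prod_law_at (s : seq reproduction_index)
    (B : reproduction_index -> set nat) :
  measurable_fun setT (fun q : Delta R => \prod_(a <- s) law_at a q (B a)).
Proof.
elim: s => [|a s IH]; first by under eq_fun do rewrite big_nil; exact: measurable_cst.
under eq_fun do rewrite big_cons.
by apply: emeasurable_funM => //; exact: measurable_law_at.
Qed.

Definition cylinder (J : {fset reproduction_index})
    (B : reproduction_index -> set nat) : set T :=
  \bigcap_(a in [set` J]) (reproduction_var N Y a @^-1` B a).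

Definition env_cylinder (K : {fset nat}) (U : nat -> set (Delta R)) : set T :=
  \bigcap_(m in [set` K]) (xi m @^-1` U m).

(** The conditional probability of a cylinder given the environment. *)
Definition cylinder_density (J : {fset reproduction_index})
    (B : reproduction_index -> set nat) (w : T) : \bar R :=
  \prod_(a <- J) reproduction_law xi a w (B a).

Lemma measurable_cylinder J B : measurable (cylinder J B).
Proof.
by apply: fin_bigcap_measurable => // a _; exact: measurable_funPTI.
Qed.

Lemma measurable_env_cylinder K U : (forall m, measurable (U m)) ->
  measurable (env_cylinder K U).
Proof.
by move=> mU; apply: fin_bigcap_measurable => // m _; exact: measurable_funPTI.
Qed.

Lemma cylinder_density_ge0 J B w : 0 <= cylinder_density J B w.
Proof. by apply: prode_ge0 => a _. Qed.

Lemma cylinder_density_fin J B w : cylinder_density J B w \is a fin_num.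
Proof.
rewrite /cylinder_density; apply: (big_ind (fun x => x \is a fin_num)) => //.
- by move=> x y; exact: fin_numM.
- by move=> a _; exact: fin_num_measure.
Qed.

Lemma measurable_cylinder_density J B :
  measurable_fun setT (cylinder_density J B).
Proof.
rewrite /cylinder_density; elim: (enum_fset J) => [|a s IH].
  by under eq_fun do rewrite big_nil; exact: measurable_cst.
under eq_fun do rewrite big_cons.
apply: emeasurable_funM => //.
under eq_fun do rewrite reproduction_lawE.
exact: (measurableT_comp (measurable_law_at a (B a)) (measurable_funPT _)).
Qed.

Lemma env_cylinder_env_events K U : [set` K] `<=` [set n | (1 <= n)%N] ->
  (forall m, measurable (U m)) -> <<s env_events xi >> (env_cylinder K U).
Proof.
move=> K1 mU; rewrite -[X in <<s X >>]/(env_events xi).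
apply: (@fin_bigcap_measurable _ (g_sigma_algebraType (env_events xi))) => //.
move=> m Km; apply: sub_sigma_algebra; exists m; first exact: K1.
by exists (U m) => //; rewrite setTI.
Qed.

Lemma cylinder_env_cylinder J B K U : [set` J] `<=` reproduction_dom ->
  [set` K] `<=` [set n | (1 <= n)%N] -> (forall m, measurable (U m)) ->
  P (env_cylinder K U `&` cylinder J B) =
  \int[P]_(w in env_cylinder K U) cylinder_density J B w.
Proof.
move=> Jdom K1 mU.
have [_ ->//] := @NY_given_xi J B Jdom (fun=> I).
exact: env_cylinder_env_events.
Qed.

Lemma cylinder_prob J B : [set` J] `<=` reproduction_dom ->
  P (cylinder J B) = \int[P]_w cylinder_density J B w.
Proof.
move=> Jdom.
have := @cylinder_env_cylinder J B fset0 (fun=> setT) Jdom _ (fun=> measurableT).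
rewrite /env_cylinder set_fset0 bigcap_set0 setTI; exact.
Qed.

Lemma prob_env_cylinder K U : [set` K] `<=` [set n | (1 <= n)%N] ->
  (forall m, measurable (U m)) ->
  P (env_cylinder K U) = \prod_(m <- K) P (xi m @^-1` U m).
Proof. by move=> K1 mU; apply: xi_iid.2. Qed.

Definition past_index (n : nat) (J : {fset reproduction_index}) : Prop :=
  [set` J] `<=` reproduction_dom /\
  (forall a, a \in J -> (generation a <= n)%N).

Definition generation_index (n : nat) (J : {fset reproduction_index}) : Prop :=
  [set` J] `<=` reproduction_dom /\
  (forall a, a \in J -> generation a = n).

Lemma cylinderU J1 J2 B :
  cylinder (J1 `|` J2)%fset B = cylinder J1 B `&` cylinder J2 B.
Proof. by rewrite /cylinder set_fsetU bigcap_setU. Qed.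

Lemma cylinder_densityU J1 J2 B w : (forall a, a \in J1 -> a \notin J2) ->
  cylinder_density (J1 `|` J2)%fset B w =
  cylinder_density J1 B w * cylinder_density J2 B w.
Proof.
by move=> J12; exact: prode_fsetU.
Qed.

Lemma env_cylinder1U n K U B0 : n \notin K ->
  env_cylinder (n |` K)%fset (fun m => if m == n then B0 else U m) =
  xi n @^-1` B0 `&` env_cylinder K U.
Proof.
move=> nK; rewrite /env_cylinder set_fsetU1 bigcap_setU1 eqxx; congr (_ `&` _).
apply: eq_bigcapr => m /= mK; case: eqP => // mn.
by rewrite mn in mK; rewrite mK in nK.
Qed.

(** Conditioning on the environment turns the event into the integral of a
    product of a factor for the past (J1), an indicator for the later
    environments (K) and a function g of the environment of generation n+1.
    The induction hypothesis, applied to K enlarged by n+1, says that the first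
    two factors decouple from every event of the environment n+1, hence from
    g. *)
Lemma past_env_indep_step n :
  (forall J B K U, past_index n J -> (forall m, m \in K -> (n < m)%N) ->
    (forall m, measurable (U m)) ->
    P (env_cylinder K U `&` cylinder J B) =
    P (env_cylinder K U) * P (cylinder J B)) ->
  forall J1 J2 B K U, past_index n J1 -> generation_index n.+1 J2 ->
    (forall m, m \in K -> (n.+1 < m)%N) -> (forall m, measurable (U m)) ->
    P (env_cylinder K U `&` cylinder (J1 `|` J2)%fset B) =
    P (env_cylinder K U) * P (cylinder J1 B) * P (cylinder J2 B).
Proof.
move=> IH J1 J2 B K U [J1dom J1n] [J2dom J2n] Kn mU.
have K1 : [set` K] `<=` [set n | (1 <= n)%N].
  by move=> m /= /Kn; apply: leq_trans.
have nK : n.+1 \notin K by apply/negP => /Kn; rewrite ltnn.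
rewrite cylinder_env_cylinder//; last first.
  by rewrite set_fsetU => a [/J1dom|/J2dom].
pose g (q : Delta R) := \prod_(a <- J2) law_at a q (B a).
have gE w : cylinder_density J2 B w = g (xi n.+1 w).
  rewrite /cylinder_density /g !big_seq; apply: eq_bigr => a aJ2.
  by rewrite reproduction_lawE J2n.
have mg : measurable_fun setT g by exact: measurable_prod_law_at.
pose Phi w := (\1_(env_cylinder K U) w)%:E * cylinder_density J1 B w.
have mF := @measurable_env_cylinder K U mU.
have intPhi A f : measurable A -> \int[P]_(w in A) ((\1_(env_cylinder K U) w)%:E * f w)
    = \int[P]_(w in A `&` env_cylinder K U) f w.
  move=> mA; rewrite integral_mkcondr; apply: eq_integral => w _.
  by rewrite epatch_indic /= muleC.
rewrite -(setTI (env_cylinder K U)) -intPhi//.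
transitivity (\int[P]_w (Phi w * g (xi n.+1 w))).
  apply: eq_integral => w _; rewrite cylinder_densityU ?gE ?muleA// => a /J1n.
  by move=> an; apply/negP => /J2n an1; rewrite an1 ltnn in an.
rewrite setTI (@ge0_integral_weighted _ _ _ _ _ _ _ _
    (fine (P (env_cylinder K U) * P (cylinder J1 B)))) //.
- rewrite fineK ?fin_numM ?fin_num_measure//; last exact: measurable_cylinder.
  congr (_ * _); rewrite cylinder_prob//; apply: eq_integral => w _.
  by rewrite gE.
- apply: emeasurable_funM; last exact: measurable_cylinder_density.
  by apply/measurable_EFinP; exact: measurable_indic.
- by move=> w; rewrite mule_ge0// ?cylinder_density_ge0// lee_fin.
- by move=> w; rewrite fin_numM// cylinder_density_fin.
- move=> B0 mB0; have mxB : measurable (xi n.+1 @^-1` B0) by exact: measurable_funPTI.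
  rewrite intPhi//.
  have mU' m : measurable (if m == n.+1 then B0 else U m) by case: ifP.
  have K'1 : [set` (n.+1 |` K)%fset] `<=` [set n | (1 <= n)%N].
    by rewrite set_fsetU1 => m [->//|]; exact: K1.
  rewrite -env_cylinder1U// -cylinder_env_cylinder// IH//; last first.
    by move=> m /fset1UP[->//|/Kn]; exact: ltnW.
  rewrite prob_env_cylinder// big_fsetU1//= eqxx.
  rewrite fineK ?fin_numM ?fin_num_measure//; last exact: measurable_cylinder.
  rewrite (prob_env_cylinder K1 mU) -muleA muleC; congr (_ * _ * _).
  rewrite !big_seq; apply: eq_bigr => m mK; case: eqP => // mn.
  by rewrite mn in mK; rewrite mK in nK.
- by move=> q; apply: prode_ge0.
Qed.

Lemma past_split n J : past_index n.+1 J ->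
  exists J1 J2, [/\ J = (J1 `|` J2)%fset, past_index n J1 &
    generation_index n.+1 J2].
Proof.
move=> [Jdom Jn].
exists [fset a in J | (generation a <= n)%N]%fset.
exists [fset a in J | ~~ (generation a <= n)%N]%fset; split.
- exact: fsetU_filter.
- by split => [a|a]; rewrite /= !inE/= => /andP[aJ]//; move=> _; exact: Jdom.
- split => [a|a]; rewrite /= !inE/= => /andP[aJ an]; first exact: Jdom.
  by apply/eqP; rewrite eqn_leq Jn//= ltnNge.
Qed.

(** The later environments are carried along because the induction step uses
    them: the environment of generation n+1 must already be known to be
    independent of the reproduction up to generation n. *)
Lemma past_env_indep n J B K U :
  past_index n J -> (forall m, m \in K -> (n < m)%N) ->
  (forall m, measurable (U m)) ->
  P (env_cylinder K U `&` cylinder J B) =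
  P (env_cylinder K U) * P (cylinder J B).
Proof.
elim: n J B K U => [|n IH] J B K U.
  move=> [Jdom Jn] _ mU; have -> : cylinder J B = setT.
    apply/seteqP; split => // w _ a /= aJ.
    have := Jdom _ aJ; have := Jn _ aJ; move: {aJ} a => [[[|n] i]|[|n]] //=.
    by move=> _ [].
  by rewrite setIT probability_setT mule1.
move=> /past_split[J1 [J2 [-> J1n J2n]]] Kn mU.
have step := @past_env_indep_step n IH J1 J2 B.
rewrite step// -muleA; congr (_ * _).
have := step fset0 (fun=> setT) J1n J2n (fun m => _) (fun=> measurableT).
rewrite /env_cylinder set_fset0 bigcap_set0 setTI probability_setT mul1e => -> //.
Qed.

Lemma past_generation_indep n J1 J2 B :
  past_index n J1 -> generation_index n.+1 J2 ->
  P (cylinder J1 B `&` cylinder J2 B) = P (cylinder J1 B) * P (cylinder J2 B).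
Proof.
move=> J1n J2n.
have := @past_env_indep_step n (@past_env_indep n) J1 J2 B fset0 (fun=> setT)
  J1n J2n (fun m => _) (fun=> measurableT).
rewrite /env_cylinder set_fset0 bigcap_set0 setTI probability_setT mul1e.
by rewrite cylinderU => ->.
Qed.

End Cylinders.

(** * The annealed Markov chain *)

Section MarkovChain.
Context d (T : measurableType d) (R : realType) (P : probability T R).
Context (Q : {RV P >-> Delta R}) (xi : nat -> {RV P >-> Delta R}).
Context (N : nat -> nat -> {RV P >-> nat}) (Y : nat -> {RV P >-> nat}).
Context (xi_iid : iid_copies Q xi).
Context (NY_given_xi : reproduction_given_env xi N Y).
Implicit Types (J : {fset reproduction_index}) (B : reproduction_index -> set nat).

(** The size of generation n when generation n-1 has the deterministic size
    y. *)
Definition next_size (n y : nat) (w : T) : nat :=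
  (\sum_(1 <= i < y.+1) N n i w + Y n w)%N.

Definition cylinders_on (I : {fset reproduction_index} -> Prop) : set (set T) :=
  [set A | exists J B, I J /\ A = cylinder N Y J B].

Lemma cylinders_on_setI I :
  (forall J1 J2, I J1 -> I J2 -> I (J1 `|` J2)%fset) ->
  setI_closed (cylinders_on I).
Proof.
move=> IU _ _ [J1 [B1 [IJ1 ->]]] [J2 [B2 [IJ2 ->]]].
exists (J1 `|` J2)%fset.
exists (fun a => [set x | (a \in J1 -> B1 a x) /\ (a \in J2 -> B2 a x)]).
split; first exact: IU.
rewrite /cylinder set_fsetU; apply/seteqP; split => w.
  move=> [w1 w2] a /= _; split => [aJ1|aJ2]; [exact: w1|exact: w2].
move=> wJ; split => a /= aJ.
  by have /= [+ _] := wJ a (or_introl aJ); exact.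
by have /= [_ +] := wJ a (or_intror aJ); exact.
Qed.

Lemma cylinders_on_measurable I : cylinders_on I `<=` measurable.
Proof. by move=> _ [J [B [_ ->]]]; exact: measurable_cylinder. Qed.

Lemma measurable_reproduction_var I a : I [fset a]%fset ->
  measurable_fun setT
    (reproduction_var N Y a : g_sigma_algebraType (cylinders_on I) -> nat).
Proof.
move=> Ia _ B mB; rewrite setTI; apply: sub_sigma_algebra.
exists [fset a]%fset, (fun=> B); split => //.
by rewrite /cylinder set_fset1 bigcap_set1.
Qed.

Lemma past_indexU n J1 J2 :
  past_index n J1 -> past_index n J2 -> past_index n (J1 `|` J2)%fset.
Proof.
move=> [d1 n1] [d2 n2]; split => [a|a].
  by rewrite set_fsetU => -[/d1|/d2].
by rewrite in_fsetU => /orP[/n1|/n2].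
Qed.

Lemma generation_indexU n J1 J2 : generation_index n J1 ->
  generation_index n J2 -> generation_index n (J1 `|` J2)%fset.
Proof.
move=> [d1 n1] [d2 n2]; split => [a|a].
  by rewrite set_fsetU => -[/d1|/d2].
by rewrite in_fsetU => /orP[/n1|/n2].
Qed.

Lemma past_index1 n a : reproduction_dom a -> (generation a <= n)%N ->
  past_index n [fset a]%fset.
Proof.
by move=> da an; split => b /=; rewrite in_fset1 => /eqP->.
Qed.

Lemma generation_index1 n a : reproduction_dom a -> generation a = n ->
  generation_index n [fset a]%fset.
Proof.
by move=> da an; split => b /=; rewrite in_fset1 => /eqP->.
Qed.

(** Stated on an arbitrary generated sigma-algebra, so as to apply both to the
    past and to a single generation. *)
Lemma measurable_next_size I n y : (0 < n)%N ->
  (forall a, reproduction_dom a -> generation a = n -> I [fset a]%fset) ->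
  measurable_fun setT
    (next_size n y : g_sigma_algebraType (cylinders_on I) -> nat).
Proof.
move=> n0 In; apply: measurable_fun_natD.
  apply: measurable_fun_natsum => i; rewrite mem_index_iota => /andP[i1 _].
  exact: (@measurable_reproduction_var I (inl (n, i)) (In _ _ _)).
exact: (@measurable_reproduction_var I (inr n) (In _ _ _)).
Qed.

Lemma measurable_bpire k n : measurable_fun setT
  (bpire N Y k n : g_sigma_algebraType (cylinders_on (past_index n)) -> nat).
Proof.
suff H m : (m <= n)%N -> measurable_fun setT
    (bpire N Y k m : g_sigma_algebraType (cylinders_on (past_index n)) -> nat).
  exact: H.
elim: m => [|m IH] mn; first exact: measurable_cst.
apply: (@measurable_fun_natdep _ (g_sigma_algebraType (cylinders_on (past_index n)))
    setT (bpire N Y k m) (next_size m.+1)).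
  by apply: IH; exact: ltnW.
move=> y; apply: measurable_next_size => // a da an.
by apply: past_index1 => //; rewrite an.
Qed.

(** The Markov property: the size of generation n depends on generations up
    to n, next_size (n+1) y only on generation n+1. *)
Lemma bpire_next_size_indep k n y (B1 B2 : set nat) :
  P (bpire N Y k n @^-1` B1 `&` next_size n.+1 y @^-1` B2) =
  P (bpire N Y k n @^-1` B1) * P (next_size n.+1 y @^-1` B2).
Proof.
apply: (@pi_lambda_indep _ _ _ _ (cylinders_on (past_index n))
    (cylinders_on (generation_index n.+1))).
- by apply: cylinders_on_setI; exact: past_indexU.
- by apply: cylinders_on_setI; exact: generation_indexU.
- exact: cylinders_on_measurable.
- exact: cylinders_on_measurable.
- move=> _ _ [J1 [C1 [J1n ->]]] [J2 [C2 [J2n ->]]].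
  (* Both cylinders can be described by one family of sets, as their indices
   lie in different generations. *)
pose C a := if (generation a <= n)%N then C1 a else C2 a.
  have -> : cylinder N Y J1 C1 = cylinder N Y J1 C.
    by apply: eq_bigcapr => a aJ1; rewrite /C J1n.2.
  have -> : cylinder N Y J2 C2 = cylinder N Y J2 C.
    by apply: eq_bigcapr => a aJ2; rewrite /C J2n.2// ltnn.
  exact: (past_generation_indep xi_iid NY_given_xi C J1n J2n).
- by have := @measurable_bpire k n measurableT B1 I; rewrite setTI.
- have := @measurable_next_size (generation_index n.+1) n.+1 y isT
    (@generation_index1 n.+1) measurableT B2 I.
  by rewrite setTI.
Qed.

Lemma sub_measurable_fun (I : {fset reproduction_index} -> Prop) (F : T -> nat) :
  measurable_fun setT (F : g_sigma_algebraType (cylinders_on I) -> nat) ->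
  measurable_fun setT F.
Proof.
move=> mF _ B mB; have := mF measurableT B mB.
suff : <<s cylinders_on I >> `<=` @measurable _ T by exact.
apply: smallest_sub; first exact: sigma_algebra_measurable.
exact: cylinders_on_measurable.
Qed.

Lemma bpire_measurable k n : measurable_fun setT (bpire N Y k n).
Proof. exact: sub_measurable_fun (@measurable_bpire k n). Qed.

Lemma next_size_measurable n y : (0 < n)%N ->
  measurable_fun setT (next_size n y).
Proof.
move=> n0; apply: sub_measurable_fun.
exact: (@measurable_next_size _ n y n0 (@generation_index1 n)).
Qed.

Lemma measurable_EFin_nat (V : nat -> R) (F : T -> nat) :
  measurable_fun setT F -> measurable_fun setT (fun w => (V (F w))%:E).
Proof.
by move=> mF; apply/measurable_EFinP; apply: (measurableT_comp (f := V)).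
Qed.

(** Decompose according to the value y of the chain at time n; on that event
    the next state is next_size (n+1) y, which is independent of the
    event. *)
Lemma integral_bpire_step k n (V : nat -> R) (rho : R) :
  (0 <= rho)%R -> (forall z, 0 <= V z)%R ->
  (forall y, \int[P]_w (V (next_size n.+1 y w))%:E <= (rho * V y)%:E) ->
  \int[P]_w (V (bpire N Y k n.+1 w))%:E <=
  rho%:E * \int[P]_w (V (bpire N Y k n w))%:E.
Proof.
move=> rho0 V0 drift.
pose A y := bpire N Y k n @^-1` [set y].
have mA y : measurable (A y).
  by rewrite -(setTI (A y)); apply: bpire_measurable.
have AT : \bigcup_y A y = setT.
  by apply/seteqP; split => // w _; exists (bpire N Y k n w).
have tA : trivIset setT A.
  apply/trivIsetP => i j _ _ /eqP ij; apply/seteqP; split => // w [wi wj].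
  by apply: ij; rewrite -wi -wj.
rewrite -ge0_integralZl//; last 2 first.
- exact: (measurable_EFin_nat _ (@bpire_measurable k n)).
- by move=> w _; rewrite lee_fin.
rewrite -AT ge0_integral_bigcup//; last 2 first.
- by rewrite AT; exact: (measurable_EFin_nat _ (@bpire_measurable k n.+1)).
- by move=> w _; rewrite lee_fin.
rewrite ge0_integral_bigcup//; last 2 first.
- rewrite AT; apply: measurable_funeM.
  exact: (measurable_EFin_nat _ (@bpire_measurable k n)).
- by move=> w _; rewrite mule_ge0// lee_fin.
apply: lee_nneseries => [y _ _|y _].
  by apply: integral_ge0 => w _; rewrite lee_fin.
have mS := @next_size_measurable n.+1 y isT.
apply: (@le_trans _ _ (\int[P]_w ((\1_(A y) w)%:E * (V (next_size n.+1 y w))%:E))).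
  rewrite integral_mkcond le_eqVlt; apply/orP; left; apply/eqP.
  apply: eq_integral => w _; rewrite epatch_indic /= indicE muleC.
  by case: (boolP (w \in A y)) => [/set_mem <-//|_]; rewrite !mul0e.
rewrite (@ge0_integral_weighted _ _ _ _ _ P (next_size n.+1 y) _
   (fine (P (A y))) (EFin \o V)); last 7 first.
- exact: mS.
- by apply/measurable_EFinP; exact: measurable_indic.
- by move=> w; rewrite lee_fin.
- by [].
- move=> B _; have mSB : measurable (next_size n.+1 y @^-1` B).
    by rewrite -(setTI (_ @^-1` _)); apply: mS.
  rewrite integral_indic// fineK ?fin_num_measure//.
  exact: bpire_next_size_indep.
- by [].
- by move=> z; rewrite lee_fin.
rewrite fineK ?fin_num_measure//.
apply: le_trans (lee_wpmul2l _ (drift y)) _ => //.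
rewrite le_eqVlt; apply/orP; left; apply/eqP.
transitivity (\int[P]_(w in A y) (rho * V y)%:E).
  by rewrite integral_cst// muleC.
by apply: eq_integral => w /set_mem <-; rewrite EFinM.
Qed.

Lemma integral_bpire_le k (V : nat -> R) (rho : R) n :
  (0 <= rho)%R -> (forall z, 0 <= V z)%R ->
  (forall n y, \int[P]_w (V (next_size n.+1 y w))%:E <= (rho * V y)%:E) ->
  \int[P]_w (V (bpire N Y k n w))%:E <= (rho ^+ n * V k)%:E.
Proof.
move=> rho0 V0 drift; elim: n => [|n IH] /=.
  by rewrite integral_cst// expr0 mul1r -[leRHS]mule1 lee_wpmul2l ?lee_fin// probability_le1.
apply: (le_trans (@integral_bpire_step k n V rho rho0 V0 (drift n))).
by rewrite exprS -mulrA EFinM lee_wpmul2l// lee_fin.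
Qed.

End MarkovChain.

(** * The law of one generation *)

Lemma prode_EFin (R : realType) (I : Type) (s : seq I) (F : I -> R) :
  \prod_(i <- s) (F i)%:E = (\prod_(i <- s) F i)%:E :> \bar R.
Proof. by rewrite (big_morph EFin (fun x y => EFinM x y) erefl). Qed.

Section OneGeneration.
Context d (T : measurableType d) (R : realType) (P : probability T R).
Context (Q : {RV P >-> Delta R}) (xi : nat -> {RV P >-> Delta R}).
Context (N : nat -> nat -> {RV P >-> nat}) (Y : nat -> {RV P >-> nat}).
Context (xi_iid : iid_copies Q xi).
Context (NY_given_xi : reproduction_given_env xi N Y).

(** Environments are identically distributed, so every one-generation
    computation can be carried out with the first of them. *)
Lemma env_stationary n (g : Delta R -> \bar R) : (0 < n)%N ->
  measurable_fun setT g -> (forall q, 0 <= g q) ->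
  \int[P]_w g (xi n w) = \int[P]_w g (xi 1%N w).
Proof.
move=> n0 mg g0.
rewrite -(ge0_integral_distribution (xi n) mg g0).
rewrite -(ge0_integral_distribution (xi 1%N) mg g0).
apply: eq_measure_integral => A mA _.
exact: (etrans (xi_iid.1 n A n0 mA) (esym (xi_iid.1 1%N A isT mA))).
Qed.

Lemma generation_prob n (s : seq reproduction_index)
    (B : reproduction_index -> set nat) :
  (0 < n)%N -> uniq s ->
  (forall a, a \in s -> reproduction_dom a /\ generation a = n) ->
  P [set w | forall a, a \in s -> B a (reproduction_var N Y a w)] =
  \int[P]_w \prod_(a <- s) law_at a (xi 1%N w) (B a).
Proof.
move=> n0 us sn.
have -> : [set w | forall a, a \in s -> B a (reproduction_var N Y a w)] =
    cylinder N Y [fset a in s]%fset B.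
  apply/seteqP; split => w ws a /=.
    by rewrite inE/= => /ws.
  by move=> aJ; apply: ws; rewrite /= inE.
rewrite (cylinder_prob NY_given_xi); last first.
  by move=> a /=; rewrite inE/= => /sn[].
pose g (q : Delta R) := \prod_(a <- s) law_at a q (B a).
rewrite -(@env_stationary n g) //.
- apply: eq_integral => w _; rewrite /cylinder_density /g.
  have sJ : perm_eq (enum_fset [fset a in s]%fset) s.
    by apply: uniq_perm => // a; rewrite inE.
  rewrite (perm_big _ sJ) !big_seq; apply: eq_bigr => a as_.
  by rewrite reproduction_lawE (sn _ as_).2.
- exact: measurable_prod_law_at.
- by move=> q; apply: prode_ge0.
Qed.

Lemma offspring_prob n y (B : 'I_y -> set nat) : (0 < n)%N ->
  P [set w | forall i : 'I_y, B i (N n i.+1 w)] =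
  \int[P]_w \prod_(i < y) offspring (xi 1%N w) (B i).
Proof.
move=> n0.
pose index (i : 'I_y) : reproduction_index := inl (n, i.+1).
pose s := [seq index i | i <- enum 'I_y].
(* A condition on all individuals at once, so that no partial inverse of
   i |-> i.+1 is needed to read off the index. *)
pose C (a : reproduction_index) : set nat := match a with
  | inl (_, j) => [set x | forall i : 'I_y, i.+1 = j -> B i x]
  | inr _ => setT end.
have CE (i : 'I_y) : C (index i) = B i.
  by apply/seteqP; split => x /= Cx; [exact: Cx|move=> j [/ord_inj ->]].
have index_inj : injective index by move=> i j [/ord_inj].
transitivity (P [set w | forall a, a \in s -> C a (reproduction_var N Y a w)]).
  congr (P _); apply/seteqP; split => w /= wB.
    by move=> _ /mapP[i _ ->]; rewrite CE; exact: wB.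
  by move=> i; rewrite -CE; apply: (wB (index i)); rewrite map_f ?mem_enum.
rewrite (@generation_prob n)//.
- apply: eq_integral => w _; rewrite /s big_map big_enum; apply: eq_bigr => i _.
  by rewrite CE.
- by rewrite map_inj_uniq// enum_uniq.
- by move=> _ /mapP[i _ ->].
Qed.

Lemma immigration_prob n (B : set nat) : (0 < n)%N ->
  P (Y n @^-1` B) = \int[P]_w immigration (xi 1%N w) B.
Proof.
move=> n0.
transitivity (P [set w | forall a, a \in [:: inr n] ->
    B (reproduction_var N Y a w)]).
  congr (P _); apply/seteqP; split => w /=.
    by move=> BY a; rewrite inE => /eqP->.
  by move=> /(_ _ (mem_head _ _)).
rewrite (@generation_prob n [:: inr n] (fun=> B))//.
  by apply: eq_integral => w _; rewrite big_seq1.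
by move=> a; rewrite inE => /eqP->.
Qed.

Definition trunc_law (M : nat) (q : Delta R) (j : 'I_M.+1) : R :=
  fine (offspring q [set x | minn x M = j]).

Lemma measurable_trunc_law M j : measurable_fun setT (fun q => @trunc_law M q j).
Proof. by apply: measurableT_comp => //; exact: measurable_offspring. Qed.

Lemma trunc_law_ge0 M q j : (0 <= @trunc_law M q j)%R.
Proof. by rewrite fine_ge0. Qed.

(** Truncation makes the vector of offspring numbers take finitely many
    values, so that the quenched expectation is a finite sum over the possible
    vectors v. *)
Lemma integral_trunc_offspring n y M (G : nat -> R) : (0 < n)%N ->
  (forall x, 0 <= G x)%R ->
  \int[P]_w (G (\sum_(i < y) minn (N n i.+1 w) M)%N)%:E =
  \int[P]_w (\sum_(v : {ffun 'I_y -> 'I_M.+1})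
    (\prod_(i < y) trunc_law (xi 1%N w) (v i)) * G (\sum_(i < y) v i)%N)%:E.
Proof.
move=> n0 G0.
pose E (v : {ffun 'I_y -> 'I_M.+1}) : set T :=
  [set w | forall i : 'I_y, minn (N n i.+1 w) M = v i].
have mE v : measurable (E v).
  have -> : E v = \bigcap_(i in [set` enum 'I_y])
      (N n (i : 'I_y).+1 @^-1` [set x | minn x M = v i]).
    apply/seteqP; split => w /= Ew i; first by move=> _; exact: Ew.
    by apply: Ew => /=; rewrite mem_enum.
  by apply: fin_bigcap_measurable => // i _; exact: measurable_funPTI.
have PE v : P (E v) =
    \int[P]_w (\prod_(i < y) trunc_law (xi 1%N w) (v i))%:E.
  rewrite (@offspring_prob n y (fun i => [set x | minn x M = v i]))//.
  apply: eq_integral => w _; rewrite -prode_EFin; apply: eq_bigr => i _.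
  by rewrite fineK// fin_num_measure.
have decomp w : (G (\sum_(i < y) minn (N n i.+1 w) M)%N)%:E =
    \sum_(v : {ffun 'I_y -> 'I_M.+1})
      ((G (\sum_(i < y) v i)%N)%:E * (\1_(E v) w)%:E).
  pose v0 := [ffun i : 'I_y => inord (minn (N n i.+1 w) M) : 'I_M.+1].
  have v0E i : v0 i = minn (N n i.+1 w) M :> nat.
    by rewrite ffunE inordK// ltnS geq_minr.
  rewrite [RHS](bigD1 v0)//= [X in _ = _ + X]big1 ?adde0; last first.
    move=> v vv0; rewrite indicE memNset ?mule0// => Ew.
    by case/eqP: vv0; apply/ffunP => i; apply/val_inj; rewrite /= v0E -Ew.
  rewrite indicE mem_set ?mule1; last by move=> i; rewrite v0E.
  by congr (G _)%:E; apply: eq_bigr => i _; rewrite v0E.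
under eq_integral do rewrite decomp.
rewrite ge0_integral_sum//; last 2 first.
- by move=> v; apply: measurable_funeM; apply/measurable_EFinP; exact: measurable_indic.
- by move=> v w _; rewrite mule_ge0// lee_fin.
have mprod v : measurable_fun setT
    (fun w => (\prod_(i < y) @trunc_law M (xi 1%N w) (v i))%:E).
  apply/measurable_EFinP; apply: measurable_prod => i _.
  exact: (measurableT_comp (measurable_trunc_law (v i)) (measurable_funPT _)).
have prod0 v w : (0 <= \prod_(i < y) @trunc_law M (xi 1%N w) (v i))%R.
  by apply: prodr_ge0 => i _; exact: trunc_law_ge0.
transitivity (\sum_(v : {ffun 'I_y -> 'I_M.+1}) \int[P]_w
   ((G (\sum_(i < y) v i)%N)%:E * (\prod_(i < y) trunc_law (xi 1%N w) (v i))%:E)).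
  apply: eq_bigr => v _.
  rewrite !ge0_integralZl_EFin//; last 2 first.
  - by move=> w _; rewrite lee_fin.
  - by apply/measurable_EFinP; exact: measurable_indic.
  - by rewrite integral_indic// setIT -PE.
rewrite -ge0_integral_sum//; last 2 first.
- by move=> v; exact: measurable_funeM.
- by move=> v w _; rewrite mule_ge0// lee_fin.
apply: eq_integral => w _; rewrite -sumEFin; apply: eq_bigr => v _.
by rewrite muleC EFinM.
Qed.

End OneGeneration.

(** * Chernoff bound for truncated offspring *)

Section RealEstimates.
Local Open Scope ring_scope.
Context (R : realType).
Implicit Types (s t u x kappa ell e : R).

(** From 1 + u <= exp u, since (1 - u + 2 u^2)(1 + u) = 1 + u^2 (1 + 2 u).  The
    range of u includes small negative values, as needed when the exponent is
    the logarithm of a mean that may be less than 1. *)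
Lemma expRN_le u : - 2^-1 <= u -> expR (- u) <= 1 - u + 2 * u ^+ 2.
Proof.
move=> u2; have u0 : 0 < 1 + u by lra.
rewrite expRN invf_ple ?posrE ?expR_gt0//; last by nra.
apply: le_trans (expR_ge1Dx u).
rewrite -div1r ler_pdivrMr; last by nra.
have : 0 <= u ^+ 2 * (1 + 2 * u) by rewrite mulr_ge0 ?sqr_ge0//; lra.
lra.
Qed.

Lemma linear_expR_decay (A c eps : R) : 0 < A -> 0 < c -> 0 < eps ->
  exists K : nat, forall y : nat, (K < y)%N ->
    (1 + y%:R) * A * expR (- (c * y%:R)) <= eps.
Proof.
move=> A0 c0 eps0.
have B0 : 0 < 8 * A / (c ^+ 2 * eps).
  by rewrite divr_gt0 ?mulr_gt0 ?exprn_gt0//.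
exists (Num.truncn (8 * A / (c ^+ 2 * eps))).+1 => y Ky.
have y1 : 1 <= y%:R :> R by rewrite ler1n; exact: leq_ltn_trans Ky.
have yB : 8 * A <= y%:R * (c ^+ 2 * eps).
  rewrite -ler_pdivrMr ?mulr_gt0 ?exprn_gt0//.
  apply: ltW; apply: lt_trans (truncnS_gt _) _.
  by rewrite ltr_nat.
rewrite expRN ler_pdivrMr ?expR_gt0//.
(* The exponential of half the argument, squared, beats any linear function. *)
have -> : c * y%:R = c * y%:R / 2 + c * y%:R / 2 by lra.
have E := expR_ge1Dx (c * y%:R / 2).
rewrite expRD.
have cy0 : 0 <= c * y%:R / 2 by rewrite !mulr_ge0// ltW.
have : (c * y%:R / 2) ^+ 2 <= expR (c * y%:R / 2) * expR (c * y%:R / 2).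
  by rewrite -expr2 lerXn2r ?nnegrE//; lra.
move=> EE.
have : eps * (c * y%:R / 2) ^+ 2 <= eps * (expR (c * y%:R / 2) * expR (c * y%:R / 2)).
  by rewrite ler_wpM2l// ltW.
apply: le_trans.
have -> : eps * (c * y%:R / 2) ^+ 2 = (y%:R * (c ^+ 2 * eps)) * y%:R / 4 by lra.
have : 8 * A * y%:R <= y%:R * (c ^+ 2 * eps) * y%:R by rewrite ler_wpM2r.
have : A * 1 <= A * y%:R by rewrite ler_wpM2l// ltW.
lra.
Qed.

(** Either S is of the order predicted by the law of large numbers, and the
    first term bounds the power, or the power is at most 1 + y and the
    exponential factor is at least 1. *)
Lemma power_split s t kappa_ell (y S : nat) :
  0 < s <= 1 -> 0 <= t -> 0 < kappa_ell ->
  expR (s * (ln (1 + y%:R) - ln (1 + S%:R))) <=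
  expR (- s * ln kappa_ell) +
    (1 + y%:R) * expR (t * ((1 + y%:R) * kappa_ell - 1 - S%:R)).
Proof.
move=> /andP[s0 s1] t0 k0.
have y0 : 0 < 1 + y%:R :> R by rewrite ltr_wpDr.
have S0 : 0 < 1 + S%:R :> R by rewrite ltr_wpDr.
have [|small] := leP ((1 + y%:R) * kappa_ell) (1 + S%:R).
  move=> large; apply: ler_wpDr; first by rewrite mulr_ge0 ?expR_ge0 ?ltW.
  rewrite ler_expR.
  have : ln ((1 + y%:R) * kappa_ell) <= ln (1 + S%:R).
    by rewrite ler_ln ?posrE// mulr_gt0.
  rewrite lnM ?posrE// => lnle.
  have : s * (ln (1 + y%:R) + ln kappa_ell - ln (1 + S%:R)) <= 0.
    by rewrite pmulr_rle0//; lra.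
  lra.
apply: ler_wpDl; first exact: expR_ge0.
apply: (@le_trans _ _ (1 + y%:R)).
  rewrite -[leRHS](lnK (x := 1 + y%:R)) ?posrE// ler_expR.
  have ly : 0 <= ln (1 + y%:R) :> R by rewrite ln_ge0// lerDl.
  have lS : 0 <= ln (1 + S%:R) :> R by rewrite ln_ge0// lerDl.
  by nra.
rewrite -[leLHS]mulr1 ler_pM2l// -[leLHS]expR0 ler_expR.
by rewrite mulr_ge0//; lra.
Qed.

(** The second-order bound on exp(-x), the quadratic term being controlled by
    the truncation level. *)
Lemma laplace_trunc (M : nat) (p : 'I_M.+1 -> R) ell t :
  (forall j, 0 <= p j) -> \sum_j p j = 1 -> ell <= \sum_j p j * j%:R ->
  0 <= t ->
  \sum_j p j * expR (- (t * j%:R)) <= expR (- (t * ell) + 2 * t ^+ 2 * M%:R ^+ 2).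
Proof.
move=> p0 p1 pell t0; apply: le_trans (expR_ge1Dx _).
apply: (@le_trans _ _ (\sum_j p j * (1 - t * j%:R + 2 * t ^+ 2 * M%:R ^+ 2))).
  apply: ler_sum => j _; rewrite ler_wpM2l//.
  have tj : 0 <= t * j%:R by rewrite mulr_ge0.
  apply: (le_trans (@expRN_le (t * j%:R) _)); first by lra.
  have jM : j%:R <= M%:R :> R by rewrite ler_nat -ltnS.
  have : (t * j%:R) ^+ 2 <= (t * M%:R) ^+ 2.
    by rewrite lerXn2r ?nnegrE ?mulr_ge0// ler_wpM2l.
  by rewrite !exprMn; lra.
under eq_bigr do rewrite mulrDr mulrBr mulr1 mulrCA.
rewrite big_split/= sumrB -mulr_suml -mulr_sumr p1.
have : t * ell <= t * \sum_j p j * j%:R by rewrite ler_wpM2l.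
lra.
Qed.

(** The vector v has the product law of y independent copies of p, so that
    power_split reduces the estimate to the y-th power of the Laplace transform
    of p.  The value of t nearly minimizes the resulting exponent, and c is the
    rate obtained. *)
Lemma trunc_power_bound (M y : nat) (p : 'I_M.+1 -> R) ell e kappa s t c :
  (0 < M)%N ->
  (forall j, 0 <= p j) -> \sum_j p j = 1 -> ell <= \sum_j p j * j%:R ->
  0 < e <= ell -> ell <= M%:R -> 0 < kappa < 1 -> 0 < s <= 1 ->
  t = (1 - kappa) * e / (4 * M%:R ^+ 2) ->
  c = ((1 - kappa) * e) ^+ 2 / (8 * M%:R ^+ 2) ->
  \sum_(v : {ffun 'I_y -> 'I_M.+1}) (\prod_(i < y) p (v i)) *
     expR (s * (ln (1 + y%:R) - ln (1 + (\sum_(i < y) v i)%N%:R))) <=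
  expR (- s * ln (kappa * ell)) +
    (1 + y%:R) * expR (t * M%:R) * expR (- (c * y%:R)).
Proof.
move=> M0 p0 p1 pell /andP[e0 eell] ellM /andP[k0 k1] s01 tE cE.
have M0' : 0 < M%:R :> R by rewrite ltr0n.
have t0 : 0 <= t.
  by rewrite tE divr_ge0 ?mulr_ge0 ?exprn_ge0 ?ltW// subr_gt0.
have kell0 : 0 < kappa * ell by rewrite mulr_gt0// (lt_le_trans e0).
have sum1 : \sum_(v : {ffun 'I_y -> 'I_M.+1}) \prod_(i < y) p (v i) = 1.
  rewrite -(bigA_distr_bigA (fun _ j => p j)) /=.
  by rewrite big1// => i _; rewrite p1.
apply: (@le_trans _ _ (\sum_(v : {ffun 'I_y -> 'I_M.+1})
   (\prod_(i < y) p (v i)) * (expR (- s * ln (kappa * ell)) +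
    (1 + y%:R) * expR (t * ((1 + y%:R) * (kappa * ell) - 1 -
       (\sum_(i < y) v i)%N%:R))))).
  apply: ler_sum => v _; rewrite ler_wpM2l ?prodr_ge0//.
  exact: power_split.
under eq_bigr do rewrite mulrDr.
rewrite big_split/= -mulr_suml sum1 mul1r lerD2l.
pose A := (1 + y%:R) * expR (t * ((1 + y%:R) * (kappa * ell) - 1)).
have -> : \sum_(v : {ffun 'I_y -> 'I_M.+1}) (\prod_(i < y) p (v i)) *
    ((1 + y%:R) * expR (t * ((1 + y%:R) * (kappa * ell) - 1 -
       (\sum_(i < y) v i)%N%:R))) =
    A * (\sum_j p j * expR (- (t * j%:R))) ^+ y.
  have -> : (\sum_j p j * expR (- (t * j%:R))) ^+ y =
      \sum_(v : {ffun 'I_y -> 'I_M.+1})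
        \prod_(i < y) (p (v i) * expR (- (t * (v i)%:R))).
    rewrite -(bigA_distr_bigA (fun _ j => p j * expR (- (t * j%:R)))) /=.
    by rewrite prodr_const card_ord.
  rewrite mulr_sumr; apply: eq_bigr => v _.
  rewrite big_split/= [RHS]mulrCA; congr (_ * _).
  rewrite -expR_sum /A -mulrA -expRD; congr (_ * expR _).
  by rewrite sumrN -mulr_sumr natr_sum; ring.
apply: (@le_trans _ _ (A * expR (- (t * ell) + 2 * t ^+ 2 * M%:R ^+ 2) ^+ y)).
  rewrite ler_wpM2l ?mulr_ge0 ?expR_ge0 ?addr_ge0//.
  rewrite lerXn2r ?nnegrE ?expR_ge0//.
    by rewrite sumr_ge0// => j _; rewrite mulr_ge0 ?expR_ge0.
  exact: laplace_trunc.
have ttE : 2 * t ^+ 2 * M%:R ^+ 2 = c.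
  by rewrite tE cE; field; rewrite gt_eqF.
have {}tE : t * ((1 - kappa) * e) = 2 * c.
  by rewrite tE cE; field; rewrite gt_eqF.
rewrite ttE /A -expRM_natl -!mulrA ler_wpM2l ?addr_ge0// -!expRD ler_expR.
have h1 : y%:R * (t * ((1 - kappa) * e)) <= y%:R * (t * ((1 - kappa) * ell)).
  by rewrite !ler_wpM2l ?subr_ge0// ltW.
have h2 : t * (kappa * ell - 1) <= t * M%:R.
  by rewrite ler_wpM2l//; nra.
rewrite tE in h1.
lra.
Qed.

End RealEstimates.

(** * The truncated mean and its negative moments *)

Section TruncatedMean.
Local Open Scope ring_scope.
Context (R : realType).
Implicit Types (q : Delta R) (e : R).

Definition partial_mean (M : nat) q : R :=
  \sum_(j < M) fine (offspring q [set (j : nat)]) * j%:R.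

(** A lower bound for the mean of the truncated offspring number that stays
    above e.  The partial sums converge to the mean of the untruncated law as M
    grows, and the floor e keeps the logarithm bounded. *)
Definition mean_floor e (M : nat) q : R := Num.max e (partial_mean M q).

Lemma trunc_law_lt M q (j : 'I_M.+1) : (j < M)%N ->
  trunc_law q j = fine (offspring q [set (j : nat)]).
Proof.
move=> jM; rewrite /trunc_law; congr (fine (offspring q _)).
by apply/seteqP; split => x /=; lia.
Qed.

Lemma sum_trunc_law M q : \sum_j @trunc_law R M q j = 1.
Proof.
apply: EFin_inj; rewrite -sumEFin.
transitivity (\sum_(j < M.+1) offspring q [set x | minn x M = j])%E.
  by apply: eq_bigr => j _; rewrite fineK// fin_num_measure.
rewrite -measure_semi_additive_ord//=.
- rewrite (_ : \big[_/_]_(_ < _) _ = setT) ?probability_setT//.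
  apply/seteqP; split => // x _.
  rewrite -(bigcup_mkord _ (fun j => [set y | minn y M = j])); exists (minn x M) => //=.
  by rewrite ltnS geq_minr.
- apply/trivIsetP => i j _ _ /eqP ij; apply/seteqP; split => // x [/= xi xj].
  by apply: ij; apply/val_inj; rewrite /= -xi -xj.
Qed.

Lemma partial_mean_le_trunc M q :
  partial_mean M q <= \sum_j @trunc_law R M q j * j%:R.
Proof.
rewrite big_ord_recr/= /partial_mean -[leLHS]addr0 lerD//; last first.
  by rewrite mulr_ge0// trunc_law_ge0.
by apply: ler_sum => j _; rewrite trunc_law_lt//=.
Qed.

Lemma partial_mean_le M q : partial_mean M q <= M%:R.
Proof.
apply: le_trans (partial_mean_le_trunc M q) _.
have -> : M%:R = \sum_j @trunc_law R M q j * M%:R.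
  by rewrite -mulr_suml sum_trunc_law mul1r.
apply: ler_sum => j _; rewrite ler_wpM2l ?trunc_law_ge0// ler_nat.
by rewrite -ltnS.
Qed.

(** A natural number is at least the indicator of its being nonzero, and
    truncation at M > 0 preserves this indicator. *)
Lemma mass_le_trunc_mean M q : (0 < M)%N ->
  1 - fine (offspring q [set 0%N]) <= \sum_j @trunc_law R M q j * j%:R.
Proof.
move=> M0; rewrite big_ord_recl/= mulr0 add0r.
have := sum_trunc_law M q; rewrite big_ord_recl/= trunc_law_lt//= => p1.
have -> : 1 - fine (offspring q [set 0%N]) =
    \sum_(j < M) @trunc_law R M q (lift ord0 j) by rewrite -[in LHS]p1 addrC addKr.
apply: ler_sum => j _; rewrite -[leLHS]mulr1 ler_wpM2l ?trunc_law_ge0//.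
by rewrite ler1n.
Qed.

Lemma measurable_partial_mean M : measurable_fun setT (partial_mean M).
Proof.
apply: measurable_sum => j; apply: measurable_funM => //.
by apply: measurableT_comp => //; exact: measurable_offspring.
Qed.

Lemma measurable_mean_floor e M : measurable_fun setT (mean_floor e M).
Proof. by apply: measurable_maxr => //; exact: measurable_partial_mean. Qed.

Lemma mean_floor_bounds e M q : e <= 1 -> (0 < M)%N ->
  e <= mean_floor e M q <= M%:R.
Proof.
move=> e1 M0; rewrite le_max lexx/= ge_max partial_mean_le andbT.
by rewrite (le_trans e1)// ler1n.
Qed.

Lemma mean_floor_le_trunc e M q : (0 < M)%N ->
  fine (offspring q [set 0%N]) <= 1 - e ->
  mean_floor e M q <= \sum_j @trunc_law R M q j * j%:R.
Proof.
move=> M0 q0; rewrite ge_max partial_mean_le_trunc andbT.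
by apply: le_trans (mass_le_trunc_mean q M0); lra.
Qed.

(** Without families of size two or more, the mean is at most f({1}). *)
Lemma mean_floor_le1 e M q : e <= 1 ->
  offspring q [set x | (2 <= x)%N] = 0%E -> mean_floor e M q <= 1.
Proof.
move=> e1 q2; rewrite ge_max e1/=.
have q1 : fine (offspring q [set 1%N]) <= 1.
  by rewrite -lee_fin fineK ?fin_num_measure// probability_le1.
have f0 (j : nat) : (2 <= j)%N -> fine (offspring q [set j]) = 0.
  move=> j2; apply/EFin_inj; rewrite fineK ?fin_num_measure//; apply/eqP.
  rewrite -measure_le0 -q2 le_measure ?inE// => x ->//=.
case: M => [|[|M]]; rewrite /partial_mean ?big_ord0// ?big_ord1 ?mulr0//.
rewrite !big_ord_recl/= mulr0 add0r mulr1 big1 ?addr0// => j _.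
by rewrite f0// mul0r.
Qed.

End TruncatedMean.

Section Environment.
Context d (T : measurableType d) (R : realType) (P : probability T R).
Context (X : {RV P >-> Delta R}).

Context (mean_fin : {ae P, forall w, 0 < mean (offspring (X w)) < +oo}).
Context (log_int : P.-integrable setT (fun w => lne (mean (offspring (X w))))).
Context (log_pos : 0 < \int[P]_w lne (mean (offspring (X w)))).

Lemma partial_mean_cvg (q : Delta R) : mean (offspring q) < +oo ->
  partial_mean M q @[M --> \oo] --> fine (mean (offspring q)).
Proof.
move=> mfin.
have m0 : 0 <= mean (offspring q).
  by apply: nneseries_ge0 => j _ _; rewrite mule_ge0// lee_fin.
suff /fine_cvgP[_] : (partial_mean M q)%:E @[M --> \oo] -->
    (fine (mean (offspring q)))%:E by [].
rewrite fineK ?ge0_fin_numE//.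
have -> : (fun M => (partial_mean M q)%:E) =
    (fun n => \sum_(0 <= j < n) j%:R%:E * offspring q [set j]).
  apply/funext => n; rewrite big_mkord /partial_mean -sumEFin.
  by apply: eq_bigr => j _; rewrite EFinM muleC fineK// fin_num_measure.
apply: is_cvg_nneseries => j _ _.
by rewrite mule_ge0// lee_fin.
Qed.

Lemma partial_mean_le_mean (q : Delta R) M : mean (offspring q) < +oo ->
  (partial_mean M q <= fine (mean (offspring q)))%R.
Proof.
move=> mfin.
have m0 : 0 <= mean (offspring q).
  by apply: nneseries_ge0 => j _ _; rewrite mule_ge0// lee_fin.
rewrite -lee_fin fineK ?ge0_fin_numE// /partial_mean -sumEFin.
apply: le_trans (nneseries_lim_ge M _); last first.
  by move=> j _ _; rewrite mule_ge0// lee_fin.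
rewrite big_mkord; apply: lee_sum => j _.
by rewrite EFinM muleC fineK// fin_num_measure.
Qed.

(** As M grows, the logarithm of mean_floor converges to the logarithm of
    max(e, m) and is dominated by |ln e| + |ln m|. *)
Lemma exists_log_mean_floor_pos (e : R) : (0 < e)%R ->
  exists M : nat, (0 < M)%N /\ 0 < \int[P]_w (ln (mean_floor e M (X w)))%:E.
Proof.
move=> e0.
pose f_ M w := (ln (mean_floor e M (X w)))%:E.
pose f w := maxe (ln e)%:E (lne (mean (offspring (X w)))).
pose g w := `|ln e|%:E + `|lne (mean (offspring (X w)))|.
have [mlog _] := integrableP _ _ _ log_int.
have mf : measurable_fun setT f by apply: measurable_maxe.
have mf_ M : measurable_fun setT (f_ M).
  apply/measurable_EFinP; apply: measurableT_comp => //.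
  exact: (measurableT_comp (measurable_mean_floor e M) (measurable_funPT _)).
have intg : P.-integrable setT g.
  apply: integrableD => //; first exact: finite_measure_integrable_cst.
  exact: integrable_abse.
have fE w : 0 < mean (offspring (X w)) < +oo ->
    f w = (ln (Num.max e (fine (mean (offspring (X w))))))%:E /\
    lne (mean (offspring (X w))) = (ln (fine (mean (offspring (X w)))))%:E.
  rewrite /f; move: (mean (offspring (X w))) => [m| |] /andP[]//.
  rewrite lte_fin => m0 _; rewrite lne_EFin//; split => //.
  rewrite -EFin_max; congr _%:E => /=.
  have [em|me] := leP e m; first by rewrite max_r// ler_ln.
  by rewrite max_l// ler_ln// ltW.
have cvgf : {ae P, forall w, setT w -> f_ ^~ w @ \oo --> f w}.
  move: mean_fin; apply: filterS => w mw _; have [-> _] := fE w mw.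
  move: mw => /andP[_ moo].
  apply: cvg_EFin; first by near=> M.
  apply: (@cvg_comp _ _ _ (fun M => mean_floor e M (X w)) (@ln R)) => /=; last first.
    by apply: continuous_ln; rewrite lt_max e0.
  set m := fine _.
  have cmax : {for m, continuous (fun x : R => Num.max e x)}.
    by apply: (@continuous_max _ _ (cst e) id m); [exact: cvg_cst|exact: cvg_id].
  apply: (continuous_cvg _ cmax); exact: partial_mean_cvg.
have domf : {ae P, forall w n, setT w -> `|f_ n w| <= g w}.
  move: mean_fin; apply: filterS => w mw n _; have [_] := fE w mw.
  rewrite /f_ /g => ->; rewrite lee_fin.
  move: mw => /andP[m0 moo].
  have m0' : (0 < fine (mean (offspring (X w))))%R by rewrite fine_gt0// m0.
  have := partial_mean_le_mean n moo.
  set m := fine _ => pm.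
  have ln1 : (ln e <= ln (mean_floor e n (X w)))%R.
    by rewrite ler_ln ?posrE ?lt_max ?e0// /mean_floor le_max lexx.
  have ln2 : (ln (mean_floor e n (X w)) <= Num.max (ln e) (ln m))%R.
    have [em|me] := leP (partial_mean n (X w)) e.
      by rewrite /mean_floor max_l// le_max lexx.
    rewrite /mean_floor max_r ?(ltW me)// le_max; apply/orP; right.
    by rewrite ler_ln// posrE; exact: lt_trans me.
  have := ler_norm (ln e); have := ler_norm (- ln e)%R.
  have := ler_norm (ln m); have := ler_norm (- ln m)%R.
  rewrite !normrN => a1 a2 a3 a4.
  rewrite ler_norml; apply/andP; split; first lra.
  apply: le_trans ln2 _; rewrite ge_max; lra.
have [intf _ cvgint] := dominated_convergence measurableT mf_ mf cvgf intg domf.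
have posf : 0 < \int[P]_w f w.
  apply: lt_le_trans log_pos _; apply: le_integral => //.
  by move=> w _; rewrite /f le_max lexx orbT.
apply: contrapT => noM; move: posf; apply/negP; rewrite -leNgt.
apply: cvge_to_le cvgint _; near=> M; rewrite leNgt; apply/negP => posM.
apply: noM; exists M; split => //; near: M; exact: nbhs_infty_gt.
Unshelve. all: by end_near. Qed.

End Environment.

Section NegativeMoments.
Context d (T : measurableType d) (R : realType) (P : probability T R).

Lemma bounded_integrable (f : T -> R) (b : R) : measurable_fun setT f ->
  (forall w, `|f w| <= b)%R -> P.-integrable setT (EFin \o f).
Proof.
move=> mf fb; apply: measurable_bounded_integrable => //.
  by rewrite fin_num_fun_lty// ; exact: fin_num_measure.
exists b; split; first exact: num_real.
by move=> x bx w _; exact: le_trans (fb w) (ltW bx).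
Qed.

(** The Laplace transform of f at s is 1 - s a + O(s^2); s = a/(8 b^2) makes
    the linear term win. *)
Lemma exists_laplace_lt1 (f : T -> R) (a b : R) : measurable_fun setT f ->
  (forall w, `|f w| <= b)%R -> \int[P]_w (f w)%:E = a%:E -> (0 < a)%R ->
  (1 <= b)%R ->
  exists s rho : R, [/\ (0 < s <= 1)%R, (0 <= rho < 1)%R &
    \int[P]_w (expR (- (s * f w)))%:E <= rho%:E].
Proof.
move=> mf fb fa a0 b1.
have intf := bounded_integrable mf fb.
have intcst (k : R) : P.-integrable setT (EFin \o cst k).
  exact: finite_measure_integrable_cst.
have intk (k : R) : \int[P]_w k%:E = k%:E by exact: integral_prob_cst.
have ab : (a <= b)%R.
  rewrite -lee_fin -fa -(intk b); apply: le_integral => //; first exact: intcst.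
  move=> w _.
  by rewrite lee_fin (le_trans (ler_norm _))// fb.
pose s := (a / (8 * b ^+ 2))%R.
have b0 : (0 < b)%R by lra.
have s0 : (0 < s)%R by rewrite divr_gt0// mulr_gt0// exprn_gt0.
have sb : (s * b <= 8^-1)%R.
  have -> : (s * b = a / b / 8)%R by rewrite /s; field; rewrite gt_eqF.
  have : (a / b <= 1)%R by rewrite ler_pdivrMr// mul1r.
  lra.
have s1 : (s <= 8^-1)%R.
  by apply: le_trans sb; rewrite ler_peMr// ltW.
have sa : (2 * s ^+ 2 * b ^+ 2 = s * a / 4)%R.
  by rewrite /s; field; rewrite gt_eqF.
have sa1 : (s * a <= 8^-1)%R by apply: le_trans sb; rewrite ler_pM2l.
have sa0 : (0 < s * a)%R by rewrite mulr_gt0.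
exists s, (1 + 2 * s ^+ 2 * b ^+ 2 - s * a)%R; split.
- lra.
- lra.
- apply: (@le_trans _ _ (\int[P]_w ((1 + 2 * s ^+ 2 * b ^+ 2)%:E - (s * f w)%:E))).
    apply: le_integral => //.
    + apply: (@bounded_integrable _ (expR (s * b))).
        apply: measurableT_comp => //; apply: measurableT_comp => //.
        exact: measurable_funM.
      move=> w; rewrite ger0_norm ?expR_ge0// ler_expR.
      have := fb w; rewrite ler_norml => /andP[fb1 fb2]; nra.
    + apply: integrableB => //; first exact: intcst.
      apply: (@bounded_integrable _ (s * b)); first exact: measurable_funM.
      by move=> w; rewrite normrM gtr0_norm// ler_pM2l.
    + move=> w _; rewrite lee_fin.
      have := fb w; rewrite ler_norml => /andP[fb1 fb2].
      apply: (le_trans (@expRN_le _ (s * f w) _)).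
        have : (s * - b <= s * f w)%R by rewrite ler_pM2l.
        lra.
      have : ((s * f w) ^+ 2 <= (s * b) ^+ 2)%R.
        have : (- (s * b) <= s * f w <= s * b)%R.
          by rewrite -mulrN !ler_pM2l// fb1 fb2.
        by move=> /andP[]; nra.
      rewrite !exprMn; lra.
  rewrite (@integralB_EFin _ _ _ P setT (cst (1 + 2 * s ^+ 2 * b ^+ 2)%R)
    (fun w => (s * f w)%R))//; last first.
    apply: (@bounded_integrable _ (s * b)); first exact: measurable_funM.
    by move=> w; rewrite normrM gtr0_norm// ler_pM2l.
  under [X in _ - X]eq_integral do rewrite EFinM.
  by rewrite integralZl// fa intk.
Qed.

(** The factor kappa leaves room for deviations below the mean; half of the
    expected logarithm is given up for it. *)
Lemma exists_negative_moment (X : {RV P >-> Delta R}) (e : R) (M : nat) :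
  (0 < e <= 1)%R -> (0 < M)%N ->
  0 < \int[P]_w (ln (mean_floor e M (X w)))%:E ->
  exists kappa s rho : R, [/\ (0 < kappa < 1)%R, (0 < s <= 1)%R, (0 <= rho < 1)%R &
    \int[P]_w (expR (- s * ln (kappa * mean_floor e M (X w))))%:E <= rho%:E].
Proof.
move=> /andP[e0 e1] M0 pos.
have bounds w := mean_floor_bounds (X w) e1 M0.
have floor0 w : (0 < mean_floor e M (X w))%R.
  by have /andP[+ _] := bounds w; exact: lt_le_trans.
have mfl : measurable_fun setT (fun w => ln (mean_floor e M (X w))).
  apply: measurableT_comp => //.
  exact: (measurableT_comp (measurable_mean_floor e M) (measurable_funPT _)).
pose b : R := (`|ln e| + `|ln (M%:R : R)|)%R.
have lnb w : (`|ln (mean_floor e M (X w))| <= b)%R.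
  have /andP[b1 b2] := bounds w.
  have l1 : (ln e <= ln (mean_floor e M (X w)))%R.
    by rewrite ler_ln ?posrE.
  have l2 : (ln (mean_floor e M (X w)) <= ln (M%:R : R))%R.
    by rewrite ler_ln ?posrE ?ltr0n.
  have := ler_norm (- ln e)%R; have := ler_norm (ln (M%:R : R)).
  have := normr_ge0 (ln e); have := normr_ge0 (ln (M%:R : R)).
  rewrite normrN ler_norml /b => ? ? ? ?; apply/andP; split; lra.
have intl := bounded_integrable mfl lnb.
have finl : \int[P]_w (ln (mean_floor e M (X w)))%:E \is a fin_num.
  exact: integrable_fin_num intl.
move: pos; rewrite -(fineK finl); set a := fine _; rewrite lte_fin => a0.
pose f w : R := (ln (expR (- (a / 2)) * mean_floor e M (X w)))%R.
have fE w : f w = (ln (mean_floor e M (X w)) - a / 2)%R.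
  by rewrite /f lnM ?posrE ?expR_gt0// expRK addrC.
have intf : \int[P]_w (f w)%:E = (a / 2)%:E.
  under eq_integral do rewrite fE EFinB.
  rewrite (integralB_EFin (f2 := cst (a / 2)%R))//; last first.
    exact: finite_measure_integrable_cst.
  rewrite [X in _ - X]integral_prob_cst -(fineK finl) -EFinB.
  by congr _%:E; rewrite -/a; lra.
have mf : measurable_fun setT f.
  by rewrite (_ : f = fun w => ln (mean_floor e M (X w)) - a / 2)%R;
    [exact: measurable_funB|exact/funext].
have [|||s [rho [s01 rho01 le]]] := @exists_laplace_lt1 f (a / 2)%R (b + a / 2 + 1)%R mf _ intf.
- move=> w; rewrite fE (le_trans (ler_normB _ _))//.
  have := lnb w; rewrite (@gtr0_norm _ (a / 2)%R); lra.
- lra.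
- have := normr_ge0 (ln e); have := normr_ge0 (ln (M%:R : R)); rewrite /b; lra.
exists (expR (- (a / 2)))%R, s, rho; split => //.
- by rewrite expR_gt0/= expR_lt1; lra.
- by under eq_integral do rewrite mulNr.
Qed.

End NegativeMoments.

(** * One-step drift for large and for small populations *)

Section Drift.
Context d (T : measurableType d) (R : realType) (P : probability T R).
Context (Q : {RV P >-> Delta R}) (xi : nat -> {RV P >-> Delta R}).
Context (N : nat -> nat -> {RV P >-> nat}) (Y : nat -> {RV P >-> nat}).
Context (xi_iid : iid_copies Q xi).
Context (NY_given_xi : reproduction_given_env xi N Y).

Lemma trunc_sum_le_next_size n y M w :
  (\sum_(i < y) minn (N n i.+1 w) M <= next_size N Y n y w)%N.
Proof.
rewrite /next_size big_add1/= big_mkord; apply: leq_trans (leq_addr _ _).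
by apply: leq_sum => i _; exact: geq_minl.
Qed.

(** Discard the immigrants, truncate, and apply the Chernoff estimate in each
    environment: the main term integrates to at most rho and the error is
    uniform in the environment and tends to 0 as y grows. *)
Lemma next_size_power_drift (e kappa s rho : R) (M : nat) :
  (0 < e <= 1)%R -> (0 < M)%N ->
  {ae P, forall w, (fine (offspring (xi 1%N w) [set 0%N]) <= 1 - e)%R} ->
  (0 < kappa < 1)%R -> (0 < s <= 1)%R -> (rho < 1)%R ->
  \int[P]_w (expR (- s * ln (kappa * mean_floor e M (xi 1%N w))))%:E <= rho%:E ->
  exists K : nat, forall n y : nat, (K < y)%N ->
    \int[P]_w (expR (s * (ln (1 + y%:R) - ln (1 + (next_size N Y n.+1 y w)%:R))))%:E
      <= ((1 + rho) / 2)%:E.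
Proof.
move=> e01 M0 ext kappa01 s01 rho1 moment.
have M0' : (0 < M%:R :> R)%R by rewrite ltr0n.
have /andP[s0 s1] := s01; have /andP[e0 e1] := e01; have /andP[k0 k1] := kappa01.
pose t : R := ((1 - kappa) * e / (4 * M%:R ^+ 2))%R.
pose c : R := (((1 - kappa) * e) ^+ 2 / (8 * M%:R ^+ 2))%R.
have c0 : (0 < c)%R.
  by rewrite divr_gt0 ?exprn_gt0 ?mulr_gt0 ?exprn_gt0// subr_gt0.
have [|K HK] := @linear_expR_decay R (expR (t * M%:R)) c ((1 - rho) / 2) (expR_gt0 _) c0.
  by rewrite divr_gt0// subr_gt0.
exists K => n y Ky.
pose G (x : nat) : R := expR (s * (ln (1 + y%:R) - ln (1 + x%:R))).
have G0 x : (0 <= G x)%R by exact: expR_ge0.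
have Gdec (x x' : nat) : (x <= x')%N -> (G x' <= G x)%R.
  move=> xx'; rewrite ler_expR ler_pM2l// lerD2l lerN2 ler_ln ?posrE ?ltr_wpDr//.
  by rewrite lerD2l ler_nat.
have mS := @next_size_measurable _ _ _ P N Y n.+1 y isT.
have mtrunc : measurable_fun setT (fun w => (\sum_(i < y) minn (N n.+1 i.+1 w) M)%N).
  apply: measurable_fun_natsum => i _.
  exact: (measurableT_comp (f := fun x => minn x M) _ (measurable_funPT _)).
apply: (@le_trans _ _ (\int[P]_w (G (\sum_(i < y) minn (N n.+1 i.+1 w) M)%N)%:E)).
  apply: ge0_le_integral => //.
  - exact: (measurable_EFin_nat G mS).
  - exact: (measurable_EFin_nat G mtrunc).
  - by move=> w _; rewrite lee_fin Gdec// trunc_sum_le_next_size.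
rewrite (integral_trunc_offspring xi_iid NY_given_xi)//.
have mfloor : measurable_fun setT
    (fun w => expR (- s * ln (kappa * mean_floor e M (xi 1%N w)))).
  apply: measurableT_comp => //; apply: measurable_funM => //.
  apply: measurableT_comp => //; apply: measurable_funM => //.
  exact: (measurableT_comp (measurable_mean_floor e M) (measurable_funPT _)).
pose err : R := ((1 + y%:R) * expR (t * M%:R) * expR (- (c * y%:R)))%R.
have err0 : (0 <= err)%R by rewrite !mulr_ge0 ?expR_ge0.
apply: (@le_trans _ _ (\int[P]_w
    ((expR (- s * ln (kappa * mean_floor e M (xi 1%N w))))%:E + err%:E))).
  apply: ae_ge0_le_integral => //.
  - move=> w _; rewrite lee_fin sumr_ge0// => v _; rewrite mulr_ge0//.
    by rewrite prodr_ge0// => i _; exact: trunc_law_ge0.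
  - apply/measurable_EFinP; apply: measurable_sum => v.
    apply: measurable_funM => //; apply: measurable_prod => i _.
    exact: (measurableT_comp (measurable_trunc_law (v i)) (measurable_funPT _)).
  - by move=> w _; rewrite -EFinD lee_fin addr_ge0 ?expR_ge0.
  - by apply: emeasurable_funD => //; exact/measurable_EFinP.
  - move: ext; apply: filterS => w ext_w _; rewrite -EFinD lee_fin.
    have /andP[ele leM] := mean_floor_bounds (xi 1%N w) e1 M0.
    apply: (@trunc_power_bound R M y (@trunc_law R M (xi 1%N w))
      (mean_floor e M (xi 1%N w)) e kappa s t c) => //.
    + exact: trunc_law_ge0.
    + exact: sum_trunc_law.
    + exact: mean_floor_le_trunc.
    + by rewrite e0.
rewrite ge0_integralD//; last exact/measurable_EFinP.
rewrite integral_prob_cst; apply: (le_trans (leeD moment (lexx _))).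
rewrite -EFinD lee_fin; have := HK y Ky; rewrite -/err; lra.
Qed.

Lemma ge0_integral_gt0 (g : T -> \bar R) : measurable_fun setT g ->
  (forall w, 0 <= g w) -> 0 < P [set w | 0 < g w] -> 0 < \int[P]_w g w.
Proof.
move=> mg g0 Pg; rewrite lt0e integral_ge0// andbT; apply/negP => /eqP int0.
have : \int[P]_w `|g w| = 0.
  by under eq_integral do rewrite gee0_abs//.
move=> /(ae_eq_integral_abs P measurableT mg)[A [mA PA subA]].
suff : P [set w | 0 < g w] <= P A by rewrite PA leNgt Pg.
rewrite le_measure ?inE//.
  by rewrite -[X in measurable X]setTI; exact: emeasurable_fun_o_infty.
by move=> w /= gw; apply: subA => /= /(_ I) gw0; rewrite gw0 ltxx in gw.
Qed.

(** Otherwise mean_floor would be at most 1 almost surely and its logarithm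
    could not have positive expectation. *)
Lemma prob_two_offspring_gt0 (e : R) (M : nat) : (0 < e <= 1)%R -> (0 < M)%N ->
  0 < \int[P]_w (ln (mean_floor e M (xi 1%N w)))%:E ->
  0 < P [set w | 0 < offspring (xi 1%N w) [set x | (2 <= x)%N]].
Proof.
move=> /andP[e0 e1] M0 pos; set A := [set w | _].
have mf2 : measurable_fun setT (fun w => offspring (xi 1%N w) [set x | (2 <= x)%N]).
  exact: (measurableT_comp (@measurable_offspring R _) (measurable_funPT _)).
have mA : measurable A.
  by rewrite -[X in measurable X]setTI; exact: emeasurable_fun_o_infty.
rewrite lt0e measure_ge0 andbT; apply/negP => /eqP PA0.
move: pos; apply/negP; rewrite -leNgt.
have lnM0 : (0 <= ln (M%:R : R))%R by rewrite ln_ge0// ler1n.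
apply: (@le_trans _ _ (\int[P]_w ((ln (M%:R : R))%:E * (\1_A w)%:E))); last first.
  rewrite ge0_integralZl_EFin//.
    have -> : \int[P]_w (\1_A w)%:E = P A by rewrite integral_indic// setIT.
    by rewrite PA0 mule0.
  by apply/measurable_EFinP; exact: measurable_indic.
have lnb w : (ln e <= ln (mean_floor e M (xi 1%N w)) <= ln (M%:R : R))%R.
  have /andP[b1 b2] := mean_floor_bounds (xi 1%N w) e1 M0.
  by rewrite !ler_ln ?posrE ?ltr0n// ?(lt_le_trans e0) ?b1.
apply: le_integral => //.
- apply: (@bounded_integrable _ _ _ _ _ (`|ln e| + `|ln (M%:R : R)|)%R).
    apply: measurableT_comp => //.
    exact: (measurableT_comp (measurable_mean_floor e M) (measurable_funPT _)).
  move=> w; have /andP[] := lnb w.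
  have := ler_norm (- ln e)%R; have := ler_norm (ln (M%:R : R)).
  have := normr_ge0 (ln e); have := normr_ge0 (ln (M%:R : R)).
  by rewrite normrN ler_norml => ? ? ? ? ? ?; apply/andP; split; lra.
- apply: integrableZl => //; apply: (@bounded_integrable _ _ _ _ _ 1%R).
    exact: measurable_indic.
  by move=> w; rewrite indicE; case: (_ \in _); rewrite ?normr0 ?normr1.
- move=> w _; rewrite -EFinM lee_fin indicE.
  have [wA|wA] := boolP (w \in A).
    by rewrite mulr1; have /andP[] := lnb w.
  rewrite mulr0 -ln1 ler_ln ?posrE//; last first.
    by have /andP[+ _] := mean_floor_bounds (xi 1%N w) e1 M0; exact: lt_le_trans.
  apply: mean_floor_le1 => //; apply/eqP; rewrite -measure_le0 leNgt.
  by apply/negP => w2; move/negP: wA; apply; rewrite inE.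
Qed.

(** From 0 the chain moves up when somebody immigrates, from y > 0 when each
    individual has at least two children.  By stationarity the probability of
    this is the same in all generations. *)
Lemma next_size_up (y : nat) :
  0 < P [set w | immigration (xi 1%N w) [set 0%N] < 1] ->
  0 < P [set w | 0 < offspring (xi 1%N w) [set x | (2 <= x)%N]] ->
  exists2 eps : R, (0 < eps)%R &
    forall n, eps%:E <= P [set w | (y < next_size N Y n.+1 y w)%N].
Proof.
move=> imm two.
have mset n : measurable [set w | (y < next_size N Y n.+1 y w)%N].
  rewrite -[X in measurable X]setTI.
  exact: (@next_size_measurable _ _ _ P N Y n.+1 y isT measurableT [set x | (y < x)%N]).
suff [v v0 vP] : exists2 v : \bar R, 0 < v &
    forall n, v <= P [set w | (y < next_size N Y n.+1 y w)%N].
  have vfin : v \is a fin_num.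
    rewrite ge0_fin_numE ?ltW//; apply: le_lt_trans (vP 0%N) _.
    by rewrite -ge0_fin_numE// fin_num_measure.
  by exists (fine v); [rewrite fine_gt0// v0 -ge0_fin_numE// ltW|rewrite fineK].
case: y mset => [|y] mset.
  exists (\int[P]_w immigration (xi 1%N w) [set x | (0 < x)%N]).
    apply: ge0_integral_gt0 => //.
      exact: (measurableT_comp (@measurable_immigration R _) (measurable_funPT _)).
    rewrite (_ : [set w | _] = [set w | immigration (xi 1%N w) [set 0%N] < 1])//.
    apply/seteqP; split => w /=.
      rewrite (_ : [set x | (0 < x)%N] = ~` [set 0%N]); last first.
        by apply/seteqP; split => x /=; case: x.
      by rewrite probability_setC// sube_gt0.
    rewrite (_ : [set x | (0 < x)%N] = ~` [set 0%N]); last first.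
      by apply/seteqP; split => x /=; case: x.
    by rewrite probability_setC// sube_gt0.
  move=> n.
  rewrite -(immigration_prob xi_iid NY_given_xi [set x | (0 < x)%N] (ltn0Sn n)).
  rewrite le_measure ?inE//.
    exact: measurable_funPTI.
  by move=> w /= Yw; rewrite /next_size (leq_trans Yw)// leq_addl.
have mtwo : measurable_fun setT
    (fun w => offspring (xi 1%N w) [set x | (2 <= x)%N]).
  exact: (measurableT_comp (@measurable_offspring R _) (measurable_funPT _)).
have mprod : measurable_fun setT
    (fun w => \prod_(i < y.+1) offspring (xi 1%N w) [set x | (2 <= x)%N]).
  elim: (y.+1) => [|m IH].
    by under eq_fun do rewrite big_ord0; exact: measurable_cst.
  by under eq_fun do rewrite big_ord_recr/=; exact: emeasurable_funM.
exists (\int[P]_w \prod_(i < y.+1) offspring (xi 1%N w) [set x | (2 <= x)%N]).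
  apply: ge0_integral_gt0 => //.
  - by move=> w; apply: prode_ge0.
  - apply: lt_le_trans two _; rewrite le_measure ?inE//.
    + by rewrite -[X in measurable X]setTI; exact: emeasurable_fun_o_infty.
    + by rewrite -[X in measurable X]setTI; exact: emeasurable_fun_o_infty.
    + move=> w /= w2; apply: (big_ind (fun x => 0 < x)) => //.
      by move=> a b a0 b0; exact: mule_gt0.
move=> n.
rewrite -(@offspring_prob _ _ _ _ _ _ _ _ xi_iid NY_given_xi n.+1 y.+1
  (fun=> [set x | (2 <= x)%N]))// le_measure ?inE//.
  rewrite (_ : [set w | _] = \bigcap_(i in [set` enum 'I_y.+1])
      (N n.+1 (i : 'I_y.+1).+1 @^-1` [set x | (2 <= x)%N])).
    by apply: fin_bigcap_measurable => // i _; exact: measurable_funPTI.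
  apply/seteqP; split => w /= Ew i; first by move=> _; exact: Ew.
  by apply: Ew => /=; rewrite mem_enum.
move=> w /= w2; rewrite /next_size big_add1/= big_mkord.
apply: leq_trans (leq_addr _ _).
apply: (@leq_trans (\sum_(i < y.+1) 2)%N).
  by rewrite sum_nat_const card_ord; lia.
by apply: leq_sum => i _; exact: w2.
Qed.

Lemma next_size_up_uniform (L : nat) :
  0 < P [set w | immigration (xi 1%N w) [set 0%N] < 1] ->
  0 < P [set w | 0 < offspring (xi 1%N w) [set x | (2 <= x)%N]] ->
  exists2 eps : R, (0 < eps <= 1)%R & forall n y, (y < L)%N ->
    eps%:E <= P [set w | (y < next_size N Y n.+1 y w)%N].
Proof.
move=> imm two; elim: L => [|L [eps /andP[eps0 eps1] epsP]].
  by exists 1%R; rewrite ?ltr01/=.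
have [eps' eps'0 eps'P] := next_size_up L imm two.
exists (Num.min eps eps'); first by rewrite lt_min eps0 eps'0 ge_min eps1.
move=> n y; rewrite ltnS leq_eqVlt => /orP[/eqP->|yL].
  by apply: le_trans (eps'P n); rewrite lee_fin ge_min lexx orbT.
by apply: le_trans (epsP n y yL); rewrite lee_fin ge_min lexx.
Qed.

End Drift.

(** * The Lyapunov function and the conclusion *)

Section Lyapunov.
Context (R : realType).
Local Open Scope ring_scope.
Implicit Types (s eps : R) (K L z : nat).

(** Increasing in z with ratio 2/eps up to L, constant equal to 1/2 from L on
    (truncated subtraction). *)
Definition low_bump eps L z : R := 2^-1 * (eps / 2) ^+ (L - z).

Definition power_weight s K z : R := expR (s * (ln (1 + K%:R) - ln (1 + z%:R))).

(** The two functions cross between K and L: below K the first one is the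
    smaller and, for L large, from L on the second one is. *)
Definition lyapunov s eps K L z : R :=
  Num.min (1 - low_bump eps L z) (power_weight s K z).

Lemma low_bump_bounds eps L z : 0 < eps <= 1 -> 0 < low_bump eps L z <= 2^-1.
Proof.
move=> /andP[e0 e1]; rewrite mulr_gt0 ?exprn_gt0 ?divr_gt0//=.
by rewrite ler_piMr// exprn_ile1 ?divr_ge0 ?ltW//; lra.
Qed.

Lemma low_bump_incr eps L z z' : 0 < eps <= 1 -> (z <= z')%N ->
  low_bump eps L z <= low_bump eps L z'.
Proof.
move=> /andP[e0 e1] zz'; rewrite ler_pM2l// ler_wiXn2l ?divr_ge0 ?ltW//; first lra.
exact: leq_sub2l.
Qed.

(** Moving up by one step with probability eps gains twice the current value
    of the bump; the second half of this gain yields a contraction factor. *)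
Lemma low_bumpS eps L z : (z < L)%N ->
  eps * low_bump eps L z.+1 = 2 * low_bump eps L z.
Proof. by move=> zL; rewrite /low_bump -(subnSK zL) exprS; field. Qed.

Lemma power_weight_gt0 s K z : 0 < power_weight s K z.
Proof. exact: expR_gt0. Qed.

Lemma power_weight_ge1 s K z : 0 <= s -> (z <= K)%N -> 1 <= power_weight s K z.
Proof.
move=> s0 zK; rewrite -[leLHS]expR0 ler_expR mulr_ge0// subr_ge0.
by rewrite ler_ln ?posrE ?ltr_wpDr// lerD2l ler_nat.
Qed.

Lemma power_weight_small s K : 0 < s ->
  exists L : nat, forall z, (L <= z)%N -> power_weight s K z < 2^-1.
Proof.
move=> s0; (* B = (1 + K) 2^(1/s) is where the power equals 1/2. *)
pose B : R := expR (ln (1 + K%:R) + ln 2 / s).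
exists (Num.truncn B).+1 => z Lz.
have Bz : B < 1 + z%:R.
  apply: lt_le_trans (truncnS_gt _) _.
  by apply: (@le_trans _ _ z%:R); [rewrite ler_nat|rewrite lerDr].
have z0 : 0 < 1 + z%:R :> R by rewrite ltr_wpDr.
have : ln B < ln (1 + z%:R) by rewrite ltr_ln ?posrE ?expR_gt0.
rewrite expRK => lnBz.
have -> : 2^-1 = expR (- ln 2) :> R by rewrite expRN lnK// posrE.
rewrite ltr_expR.
have : s * (ln (1 + K%:R) + ln 2 / s) < s * ln (1 + z%:R) by rewrite ltr_pM2l.
by rewrite mulrDr (mulrCA s) divff ?gt_eqF// mulr1; lra.
Qed.

Lemma lyapunov_bounds s eps K L z : 0 < eps <= 1 -> 0 < s ->
  2^-1 * expR (- (s * ln (1 + z%:R))) <= lyapunov s eps K L z <= 1.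
Proof.
move=> e01 s0; have := low_bump_bounds L z e01 => /andP[b0 b1].
have lz : 0 <= ln (1 + z%:R) :> R by rewrite ln_ge0// lerDl.
have lK : 0 <= ln (1 + K%:R) :> R by rewrite ln_ge0// lerDl.
have e1 : expR (- (s * ln (1 + z%:R))) <= 1.
  by rewrite -[leRHS]expR0 ler_expR oppr_le0 mulr_ge0// ltW.
apply/andP; split; last by rewrite ge_min; apply/orP; left; lra.
rewrite le_min; apply/andP; split; first by lra.
apply: (@le_trans _ _ (expR (- (s * ln (1 + z%:R))))).
  by rewrite ler_piMl ?expR_ge0//; lra.
rewrite ler_expR mulrBr.
have : 0 <= s * ln (1 + K%:R) by rewrite mulr_ge0// ltW.
lra.
Qed.

End Lyapunov.

Section LyapunovDrift.
Context d (T : measurableType d) (R : realType) (P : probability T R).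

(** Where the minimum is attained by either function, it suffices to control
    the drift of that function, as V is bounded by both.  If it is the first
    one, then y < L and the chance of moving up gives
    E V <= 1 - eps bump(y+1) = 1 - 2 bump(y) <= (1 - bump(0)) (1 - bump(y));
    if it is the second one, then K < y. *)
Lemma lyapunov_drift (F : nat -> T -> nat) (s eps rho : R) (K L : nat) (y : nat) :
  (0 < eps <= 1)%R -> (0 < s)%R -> (0 <= rho)%R ->
  measurable_fun setT (F y) ->
  (forall z, (L <= z)%N -> power_weight s K z < 2^-1)%R ->
  ((y < L)%N -> eps%:E <= P [set w | (y < F y w)%N]) ->
  ((K < y)%N ->
    \int[P]_w (expR (s * (ln (1 + y%:R) - ln (1 + (F y w)%:R))))%:E <= rho%:E) ->
  \int[P]_w (lyapunov s eps K L (F y w))%:E <=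
  (Num.max rho (1 - low_bump eps L 0) * lyapunov s eps K L y)%:E.
Proof.
move=> e01 s0 rho0 mF small up power.
have /andP[eps0 eps1] := e01.
have lyap0 z : (0 <= lyapunov s eps K L z)%R.
  have /andP[+ _] := lyapunov_bounds K L z e01 s0; apply: le_trans.
  by rewrite mulr_ge0 ?expR_ge0.
have bump z := low_bump_bounds L z e01.
have [V12|V21] := leP (1 - low_bump eps L y)%R (power_weight s K y).
  have yL : (y < L)%N.
    rewrite ltnNge; apply/negP => /small; have /andP[_] := bump y; lra.
  rewrite {2}/lyapunov min_l//.
  apply: (@le_trans _ _ (1 - (eps * low_bump eps L y.+1)%:E)); last first.
    rewrite low_bumpS// -EFinB lee_fin.
    have := low_bump_incr L e01 (leq0n y); have /andP[a1 a2] := bump y.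
    have /andP[a3 a4] := bump 0%N; move=> a5.
    apply: (@le_trans _ _ ((1 - low_bump eps L 0) * (1 - low_bump eps L y))%R).
      have : (0 <= (low_bump eps L y - low_bump eps L 0) * (1 - low_bump eps L y))%R.
        by rewrite mulr_ge0; lra.
      have := sqr_ge0 (low_bump eps L y); nra.
    by rewrite ler_wpM2r ?le_max ?lexx ?orbT//; lra.
  have mA : measurable [set w | (y < F y w)%N].
    rewrite -[X in measurable X]setTI.
    exact: (mF measurableT [set x | (y < x)%N]).
  have /andP[b0 b1] := bump y.+1.
  rewrite leeBrDr//.
  apply: (@le_trans _ _ (\int[P]_w ((lyapunov s eps K L (F y w))%:E +
     (low_bump eps L y.+1)%:E * (\1_[set w | (y < F y w)%N] w)%:E))); last first.
    rewrite -[leRHS](integral_prob_cst P); apply: ge0_le_integral => //.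
    - by move=> w _; rewrite adde_ge0// ?mule_ge0// lee_fin// ltW.
    - apply: emeasurable_funD; first exact: measurable_EFin_nat.
      by apply: measurable_funeM; apply/measurable_EFinP; exact: measurable_indic.
    - move=> w _; rewrite -EFinM -EFinD lee_fin indicE.
      have Vle : (lyapunov s eps K L (F y w) <= 1 - low_bump eps L (F y w))%R.
        by rewrite ge_min lexx.
      have /andP[c0 c1] := bump (F y w).
      have [/set_mem /= yF|_] := boolP (w \in _); last by rewrite mulr0; lra.
      have := low_bump_incr L e01 yF; lra.
  rewrite ge0_integralD//; last 4 first.
  - by move=> w _; rewrite lee_fin.
  - exact: measurable_EFin_nat.
  - by move=> w _; rewrite mule_ge0// lee_fin// ltW.
  - by apply: measurable_funeM; apply/measurable_EFinP; exact: measurable_indic.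
  rewrite leeD2l// ge0_integralZl_EFin//; last 2 first.
  - by apply/measurable_EFinP; exact: measurable_indic.
  - exact: ltW.
  rewrite integral_indic// setIT mulrC EFinM.
  by rewrite lee_wpmul2l ?lee_fin ?(ltW b0)//; exact: up.
have Ky : (K < y)%N.
  rewrite ltnNge; apply/negP => /(power_weight_ge1 (ltW s0)).
  have /andP[] := bump y; lra.
rewrite {2}/lyapunov min_r; last exact: ltW.
have p0 := power_weight_gt0 s K y.
apply: (@le_trans _ _ (\int[P]_w ((power_weight s K y)%:E *
    (expR (s * (ln (1 + y%:R) - ln (1 + (F y w)%:R))))%:E))).
  apply: ge0_le_integral => //.
  - by move=> w _; rewrite lee_fin.
  - exact: measurable_EFin_nat.
  - apply: measurable_funeM.
    exact: (measurable_EFin_nat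
      (fun x : nat => expR (s * (ln (1 + y%:R) - ln (1 + x%:R))))%R mF).
  - move=> w _; rewrite -EFinM lee_fin ge_min; apply/orP; right.
    rewrite /power_weight -expRD ler_expR; lra.
rewrite ge0_integralZl_EFin//; last 2 first.
- exact: (measurable_EFin_nat
    (fun x : nat => expR (s * (ln (1 + y%:R) - ln (1 + x%:R))))%R mF).
- exact: ltW.
rewrite mulrC EFinM; apply: (le_trans (lee_wpmul2l _ (power Ky))).
  by rewrite lee_fin ltW.
by rewrite lee_wpmul2l ?lee_fin ?(ltW p0)// le_max lexx.
Qed.

(** The inequality of Markov for V(Z n), which is bounded below on the event
    because V decreases at most like 1/(1+z) and s <= 1. *)
Lemma lyapunov_tail (Z : nat -> T -> nat) (s eps r : R) (K L n : nat) (theta : R) :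
  (0 < eps <= 1)%R -> (0 < s <= 1)%R -> (0 < theta)%R ->
  measurable_fun setT (Z n) ->
  \int[P]_w (lyapunov s eps K L (Z n w))%:E <= (expR (- r * n%:R))%:E ->
  P [set w | (1 <= Z n w)%N /\ ((Z n w)%:R <= expR (theta * n%:R))%R] <=
  (4 * expR (- (r - theta) * n%:R))%:E.
Proof.
move=> e01 /andP[s0 s1] th0 mZ EV.
set A := [set w | _].
have mA : measurable A.
  rewrite -[X in measurable X]setTI.
  exact: (mZ measurableT [set x | (1 <= x)%N /\ (x%:R <= expR (theta * n%:R))%R]).
pose v : R := (2^-1 * expR (- (ln 2 + theta * n%:R)))%R.
have v0 : (0 < v)%R by rewrite mulr_gt0// expR_gt0.
have vA w : A w -> (v <= lyapunov s eps K L (Z n w))%R.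
  move=> [_ Zle]; have /andP[+ _] := lyapunov_bounds K L (Z n w) e01 s0.
  apply: le_trans; rewrite ler_pM2l// ler_expR lerN2.
  have lz : (0 <= ln (1 + (Z n w)%:R) :> R)%R by rewrite ln_ge0// lerDl.
  apply: (@le_trans _ _ (ln (1 + (Z n w)%:R))); first by rewrite ler_piMl.
  have -> : (ln 2 + theta * n%:R = ln (2 * expR (theta * n%:R)))%R.
    by rewrite lnM ?posrE ?expR_gt0// expRK.
  rewrite ler_ln ?posrE ?mulr_gt0 ?expR_gt0 ?ltr_wpDr//.
  have : (1 <= expR (theta * n%:R))%R.
    by rewrite -[leLHS]expR0 ler_expR mulr_ge0// ltW.
  lra.
have : v%:E * P A <= (expR (- r * n%:R))%:E.
  apply: le_trans EV.
  have -> : P A = \int[P]_w (\1_A w)%:E by rewrite integral_indic// setIT.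
  rewrite -ge0_integralZl_EFin//; last 2 first.
  - by apply/measurable_EFinP; exact: measurable_indic.
  - exact: ltW.
  apply: ge0_le_integral => //.
  - by move=> w _; rewrite mule_ge0// lee_fin// ltW.
  - by apply: measurable_funeM; apply/measurable_EFinP; exact: measurable_indic.
  - exact: measurable_EFin_nat.
  - move=> w _; rewrite -EFinM lee_fin indicE.
    have [/set_mem|_] := boolP (w \in A); first by rewrite mulr1; exact: vA.
    rewrite mulr0; have /andP[+ _] := lyapunov_bounds K L (Z n w) e01 s0.
    by apply: le_trans; rewrite mulr_ge0 ?expR_ge0.
rewrite muleC -lee_pdivlMr// => /le_trans; apply.
rewrite -EFinM lee_fin /v invfM invrK -expRN opprK expRD lnK ?posrE//.
have -> : (- (r - theta) * n%:R = - r * n%:R + theta * n%:R)%R by lra.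
by rewrite expRD; lra.
Qed.

End LyapunovDrift.

(** The event only concerns the law of the environment, which is the same for
    Q and for the first generation. *)
Lemma extinction_mass_ae (R : realType) d (T : measurableType d) (P : probability T R)
    (Q : {RV P >-> Delta R}) (xi : nat -> {RV P >-> Delta R})
    (delta : R) :
  iid_copies Q xi ->
  {ae P, forall w, offspring (Q w) [set 0%N] < delta%:E} ->
  {ae P, forall w, (fine (offspring (xi 1%N w) [set 0%N]) <= delta)%R}.
Proof.
move=> iid aeQ.
pose B : set (Delta R) := [set q | delta%:E <= offspring q [set 0%N]].
have mB : measurable B.
  rewrite -[X in measurable X]setTI; apply: emeasurable_fun_c_infty => //.
  exact: measurable_offspring.
exists (xi 1%N @^-1` B); split; first exact: measurable_funPTI.
  rewrite iid.1//; have [A [mA PA subA]] := aeQ.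
  apply/eqP; rewrite -measure_le0 -PA le_measure ?inE//.
    exact: measurable_funPTI.
  by move=> w /= Bw; apply: subA => /= /lt_geF; rewrite Bw.
move=> w /= /negP; rewrite -ltNge /B /= => lt.
by rewrite -(fineK (fin_num_measure (offspring (xi 1%N w)) [set 0%N] _))// lee_fin ltW.
Qed.

Unset Implicit Arguments.

Theorem theorem3p2 (R : realType) (d : measure_display) (T : measurableType d)
    (P : probability T R)
    (Q : {RV P >-> Delta R}) (xi : nat -> {RV P >-> Delta R})
    (N : nat -> nat -> {RV P >-> nat}) (Y : nat -> {RV P >-> nat})
    (xi_iid : iid_copies Q xi)
    (NY_given_xi : reproduction_given_env xi N Y)
    (m1_pos_fin : {ae P, forall w, 0 < mean (offspring (xi 1%N w)) < +oo})
    (log_m1_int : P.-integrable setT (fun w => lne (mean (offspring (xi 1%N w)))))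
    (supercritical : 0 < \int[P]_w lne (mean (offspring (xi 1%N w))) < +oo)
    (immigration_nontrivial :
       0 < P [set w | immigration (Q w) [set 0%N] < 1])
    (condA : 0 < P [set w | [/\ 0 < immigration (Q w) [set 0%N],
                                0 < offspring (Q w) [set 0%N] &
                                0 < offspring (Q w) [set 1%N]]])
    (condB : exists delta : R, (0 < delta < 1)%R /\
       {ae P, forall w, offspring (Q w) [set 0%N] < delta%:E}) :
  exists theta beta C : R,
    [/\ (0 < theta)%R,
        theta%:E < \int[P]_w lne (mean (offspring (xi 1%N w))),
        (0 < beta)%R,
        (0 < C)%R &
        forall k n : nat, (1 <= k)%N -> (1 <= n)%N ->
          P [set w | (1 <= bpire N Y k n w)%N /\
                     ((bpire N Y k n w)%:R <= expR (theta * n%:R))%R]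
          <= (C * expR (- beta * n%:R))%:E].
Proof.
have [delta [/andP[delta0 delta1] extQ]] := condB.
pose e : R := (1 - delta)%R.
have e01 : (0 < e <= 1)%R by apply/andP; split; rewrite /e; lra.
have ext : {ae P, forall w, (fine (offspring (xi 1%N w) [set 0%N]) <= 1 - e)%R}.
  by rewrite /e subKr; exact: extinction_mass_ae xi_iid extQ.
have /andP[logpos logfin] := supercritical.
have /andP[e0 e1] := e01.
have [M [M0 floorpos]] := exists_log_mean_floor_pos m1_pos_fin log_m1_int logpos e0.
have [kappa [s [rho0 [kappa01 s01 /andP[rho00 rho01] moment]]]] :=
  exists_negative_moment e01 M0 floorpos.
have [K power] := next_size_power_drift xi_iid NY_given_xi e01 M0 ext kappa01 s01
  rho01 moment.
have /andP[s0 s1] := s01.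
have [L small] := power_weight_small K s0.
have two := prob_two_offspring_gt0 e01 M0 floorpos.
have imm : 0 < P [set w | immigration (xi 1%N w) [set 0%N] < 1].
  pose B : set (Delta R) := [set q | immigration q [set 0%N] < 1].
  have mB : measurable B.
    rewrite -[X in measurable X]setTI; apply: emeasurable_fun_infty_o => //.
    exact: measurable_immigration.
  by have := xi_iid.1 1%N B isT mB; rewrite /B /preimage /= => ->.
have [eps eps01 up] := next_size_up_uniform xi_iid NY_given_xi L imm two.
pose rho := Num.max ((1 + rho0) / 2)%R (1 - low_bump eps L 0)%R.
have /andP[bump0 bump1] := low_bump_bounds L 0 eps01.
have rho_gt0 : (0 < rho)%R by rewrite lt_max; apply/orP; left; lra.
have rho_lt1 : (rho < 1)%R by rewrite gt_max; apply/andP; split; lra.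
have V0 z : (0 <= lyapunov s eps K L z)%R.
  have /andP[+ _] := lyapunov_bounds K L z eps01 s0; apply: le_trans.
  by rewrite mulr_ge0 ?expR_ge0.
have drift n y : \int[P]_w (lyapunov s eps K L (next_size N Y n.+1 y w))%:E <=
    (rho * lyapunov s eps K L y)%:E.
  apply: (@lyapunov_drift _ _ _ P (next_size N Y n.+1) s eps ((1 + rho0) / 2)%R) => //.
  - by lra.
  - exact: next_size_measurable.
  - exact: up.
  - exact: power.
pose r : R := (- ln rho)%R.
have r0 : (0 < r)%R by rewrite oppr_gt0 -ln1 ltr_ln ?posrE.
pose m := \int[P]_w lne (mean (offspring (xi 1%N w))).
have mfin : m \is a fin_num by rewrite ge0_fin_numE// ltW.
have mpos : (0 < fine m)%R by rewrite fine_gt0// logpos.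
exists (Num.min (fine m / 2) (r / 2))%R, (r / 2)%R, 4%R.
have th_pos : (0 < Num.min (fine m / 2) (r / 2))%R.
  by rewrite lt_min !divr_gt0.
split => //.
- rewrite -/m -(fineK mfin) lte_fin gt_min; apply/orP; left; lra.
- by rewrite divr_gt0.
move=> k n k1 n1.
apply: (le_trans (@lyapunov_tail _ _ _ P (bpire N Y k) s eps r K L n _ eps01 s01
  th_pos _ _)).
- exact: bpire_measurable.
- apply: (le_trans (integral_bpire_le xi_iid NY_given_xi k n (ltW rho_gt0) V0 drift)).
  rewrite lee_fin /r opprK mulr_natr -lnXn// lnK ?posrE ?exprn_gt0//.
  rewrite ler_piMr//; first by rewrite exprn_ge0// ltW.
  by have /andP[_] := lyapunov_bounds K L k eps01 s0.
rewrite lee_fin ler_pM2l// ler_expR ler_wpM2r//.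
have : (Num.min (fine m / 2) (r / 2) <= r / 2)%R by rewrite ge_min lexx orbT.
lra.
Qed.
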